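(* Consider the controlled parameter-dependent nonlinear dynamical system $$\dot x(t)=F(x(t),\theta_{\mathrm s},u(t),a(t)),\quad x(0)=x_0,\quad t\ge 0,$$ with cost functional $$J(x_0,\theta_{\mathrm s},u(\cdot),a(\cdot))=\int_0^{T_{\mathrm p}} r(x(t),u(t),a(t))\,\mathrm dt ,$$ where the controller $u(\cdot)$ is a player that minimizes $J$ and the adversary $a(\cdot)$ is a player that maximizes $J$. Let $\mathcal S\subset\mathcal D$ be a set of admissible states with $0\in\mathcal S$ and let $T_{\mathrm p}>0$ be a predefined time. For every $x_0\in\mathcal S$, let $\mathcal F(x_0,\mathcal S,T_{\mathrm p})\subset\mathcal U\times\mathcal A$ be the set of safely predefined-time stabilizing pairs of feedback strategies and suppose that it is nonempty. Assume that there exist a continuously differentiable function $V:\mathcal S\to\mathbb R$, a system parameter vector $\theta_{\mathrm s}\in\mathbb R^{N_{\mathrm s}}$, real numbers $\alpha,\beta,p,q,r>0$ with $pr<1$ and $qr>1$, a control strategy $u^\star:\mathcal S\times\mathbb R^{N_{\mathrm c}}\to U$ and an adversary strategy $a^\star:\mathcal S\times\mathbb R^{N_{\mathrm a}}\to A$, with parameter vectors $\theta_{\mathrm c}\in\mathbb R^{N_{\mathrm c}}$, $\theta_{\mathrm a}\in\mathbb R^{N_{\mathrm a}}$, such that \begin{align*} & H(x,\theta_{\mathrm s},u^\star(x,\theta_{\mathrm c}),a^\star(x,\theta_{\mathrm a}),V'^{\mathrm T}(x))=0,\quad x\in\mathcal S,\\ & H(x,\theta_{\mathrm s},u^\star(x,\theta_{\mathrm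 c}),a,V'^{\mathrm T}(x))\le 0,\quad (x,a)\in\mathcal S\times A,\\ & H(x,\theta_{\mathrm s},u,a^\star(x,\theta_{\mathrm a}),V'^{\mathrm T}(x))\ge 0,\quad (x,u)\in\mathcal S\times U,\\ & u^\star(0,\theta_{\mathrm c})=0,\qquad a^\star(0,\theta_{\mathrm a})=0,\\ & V(0)=0,\qquad V(x)>0,\ x\in\mathcal S\setminus\{0\},\qquad V(x)\to\infty \text{ as } x\to\partial\mathcal S,\\ & V'(x)F(x,\theta_{\mathrm s},u^\star(x,\theta_{\mathrm c}),a^\star(x,\theta_{\mathrm a}))\le-\frac{\gamma}{T_{\mathrm p}}\big(\alpha V^p(x)+\beta V^q(x)\big)^r,\quad x\in\mathcal S, \end{align*} where $$\gamma=\frac{\Gamma\!\left(\frac{1-rp}{q-p}\right)\Gamma\!\left(\frac{rq-1}{q-p}\right)}{\alpha^r\,\Gamma(r)\,(q-p)}\left(\frac{\alpha}{\beta}\right)^{\frac{1-rp}{q-p}} .$$ If either $\mathcal S$ is bounded, or $\mathcal S$ is unbounded and $V$ is coercive, then with the feedback control strategy $u(\cdot)=u^\star(x(\cdot),\theta_{\mathrm c})$ and the feedback adversary strategy $a(\cdot)=a^\star(x(\cdot),\theta_{\mathrm a})$ the zero solution $x(t)\equiv0$ of the closed-loop system $$\dot x(t)=F(x(t),\theta_{\mathrm s},u^\star(x(t),\theta_{\mathrm c}),a^\star(x(t),\theta_{\mathrm a})),\quad x(0)=x_0,\quad t\ge0,$$ is safely predefined-time stable with predefined time $T_{\mathrm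 p}$ with respect to $\mathcal S$. Furthermore, if $x_0\in\mathcal S$, then the pair of feedback strategies $(u^\star(\cdot),a^\star(\cdot))$ is the Nash equilibrium of the two-player zero-sum game in the sense that \begin{align*} J(x_0,\theta_{\mathrm s},u^\star(x(\cdot),\theta_{\mathrm c}),a^\star(x(\cdot),\theta_{\mathrm a})) &=\min_{u(\cdot)\in\mathcal F_u(x_0,\mathcal S,T_{\mathrm p})}\ \max_{a(\cdot)\in\mathcal F_a(x_0,\mathcal S,T_{\mathrm p})}J(x_0,\theta_{\mathrm s},u(\cdot),a(\cdot))\\ &=\max_{a(\cdot)\in\mathcal F_a(x_0,\mathcal S,T_{\mathrm p})}\ \min_{u(\cdot)\in\mathcal F_u(x_0,\mathcal S,T_{\mathrm p})}J(x_0,\theta_{\mathrm s},u(\cdot),a(\cdot)), \end{align*} and the Nash value is $$J(x_0,\theta_{\mathrm s},u^\star(x(\cdot),\theta_{\mathrm c}),a^\star(x(\cdot),\theta_{\mathrm a}))=V(x_0).$$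
   Context: System. $\mathcal D\subseteq\mathbb R^n$ is open with $0\in\mathcal D$; $\theta_{\mathrm s}\in\mathbb R^{N_{\mathrm s}}$ is the system parameter vector; $U\subseteq\mathbb R^{m_u}$ and $A\subseteq\mathbb R^{m_a}$ contain $0$; $F:\mathcal D\times\mathbb R^{N_{\mathrm s}}\times U\times A\to\mathbb R^n$ is such that $F(\cdot,\theta_{\mathrm s},\cdot,\cdot)$ is jointly continuous on $\mathcal D\times U\times A$ for every $\theta_{\mathrm s}$, and $F(0,\cdot,0,0)=0$. The running cost $r:\mathcal S\times U\times A\to\mathbb R$ is jointly continuous (the function $r(\cdot,\cdot,\cdot)$ is unrelated to the real exponent $r$). Admissible controls and adversaries: $\mathcal U=\{u:[0,\infty)\to U \text{ Lebesgue measurable}\}$, $\mathcal A=\{a:[0,\infty)\to A\text{ Lebesgue measurable}\}$. It is a standing assumption that the required properties for existence and uniqueness of solutions of the controlled system are satisfied; $s(t,x_0,\theta_{\mathrm s},u(\cdot),a(\cdot))$, $t\ge0$, denotes the solution. Strategies. A control strategy is a map $u^\star:\mathcal S\times\mathbb R^{N_{\mathrm c}}\to U$ with $u^\star(\cdot,\theta_{\mathrm c})$ Lebesgue measurable on $\mathcal S$ for every $\theta_{\mathrm c}$ and $u^\star(0,\cdot)=0$; an adversary strategy is a map $a^\star:\mathcal S\times\mathbb R^{N_{\mathrm a}}\to A$ with $a^\star(\cdot,\theta_{\mathrm a})$ Lebesgue measurable on $\mathcal S$ for every $\theta_{\mathrm a}$ and $a^\star(0,\cdot)=0$. If $u(t)=u^\star(x(t),\theta_{\mathrm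 c})$ and $a(t)=a^\star(x(t),\theta_{\mathrm a})$, $t\ge0$, where $x(t)$ solves the controlled system, then $u(\cdot)$ is called a feedback control strategy and $a(\cdot)$ a feedback adversary strategy; $(u^\star(\cdot),a^\star(\cdot))$ denotes such a pair. Safe predefined-time stability. For $\dot x=f(x,\theta)$, $x(0)=x_0$, with $f(\cdot,\theta)$ defined on $\mathcal D$, $f(0,\cdot)=0$, and solution $s(t,x_0,\theta)$, the zero solution is safely predefined-time stable with predefined time $T_{\mathrm p}$ with respect to $\mathcal S$ if there exists a parameter $\theta$ such that for every $x_0\in\mathcal S$ the solution satisfies $\operatorname{dist}(s(t,x_0,\theta),\mathcal S)\equiv0$ (which expresses that $\mathcal S$ is positively invariant) and $s(t,x_0,\theta)=0$ for all $t\ge T_{\mathrm p}$. Here $\operatorname{dist}(y,C)=\inf_{x\in C}\|y-x\|$. The closed-loop system is regarded as such a system with $\theta=[\theta_{\mathrm s}^{\mathrm T},\theta_{\mathrm c}^{\mathrm T},\theta_{\mathrm a}^{\mathrm T}]^{\mathrm T}$ and $f(x,\theta)=F(x,\theta_{\mathrm s},u^\star(x,\theta_{\mathrm c}),a^\star(x,\theta_{\mathrm a}))$. Strategy sets. For $x_0\in\mathcal S$, $\mathcal F(x_0,\mathcal S,T_{\mathrm p})\subset\mathcal U\times\mathcal A$ is the set of pairs $(u(\cdot),a(\cdot))$ of a feedback control strategy and a feedback adversary strategy such that the solution of the controlled system (with the system parameter $\theta_{\mathrm s}$ under consideration) satisfies $\operatorname{dist}(s(t,x_0,\theta_{\mathrm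 s},u(\cdot),a(\cdot)),\mathcal S)\equiv0$ (that is, the solution remains in $\mathcal S$) and $s(t,x_0,\theta_{\mathrm s},u(\cdot),a(\cdot))=0$ for all $t\ge T_{\mathrm p}$. The sets $\mathcal F_u(x_0,\mathcal S,T_{\mathrm p})\subset\mathcal U$ and $\mathcal F_a(x_0,\mathcal S,T_{\mathrm p})\subset\mathcal A$ are the sets of feedback control strategies and feedback adversary strategies such that $\mathcal F_u(x_0,\mathcal S,T_{\mathrm p})\times\mathcal F_a(x_0,\mathcal S,T_{\mathrm p})=\mathcal F(x_0,\mathcal S,T_{\mathrm p})$. Hamiltonian. $H(x,\theta_{\mathrm s},u,a,\lambda)=r(x,u,a)+\lambda^{\mathrm T}F(x,\theta_{\mathrm s},u,a)$ for $(x,\theta_{\mathrm s},u,a,\lambda)\in\mathcal S\times\mathbb R^{N_{\mathrm s}}\times U\times A\times\mathbb R^n$. Other notation. $V'(x)$ is the gradient of $V$ as a row vector; $\Gamma$ is the gamma function; $\partial\mathcal S$ is the boundary of $\mathcal S$. For unbounded $\mathcal S$, $V:\mathcal S\to\mathbb R$ is coercive if $V(x_k)\to\infty$ for every sequence $\{x_k\}$ in $\mathcal S$ with $\|x_k\|\to\infty$. *)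

(* Defs.v *)
From HB Require Import structures.
From mathcomp Require Import all_boot all_order all_algebra.
From mathcomp Require Import all_classical all_reals all_analysis.

Set Implicit Arguments.
Unset Strict Implicit.
Unset Printing Implicit Defensive.

Import Order.TTheory GRing.Theory Num.Theory.
Import numFieldNormedType.Exports.

Local Open Scope classical_set_scope.
Local Open Scope ring_scope.

(* Vectors of R^n are row vectors, with the library's (sup) norm: distances are
   only compared with 0, and norms are only used to express divergence, so the
   choice among the equivalent norms is immaterial. *)

Definition dot (R : realType) (n : nat) (v w : 'rV[R]_n) : R :=
  (v *m w^T) 0 0.

Definition dist (R : realType) (n : nat) (y : 'rV[R]_n) (C : set 'rV[R]_n) : R :=
  inf [set `|y - x| | x in C].

Definition boundary (T : topologicalType) (C : set T) : set T :=
  closure C `\` interior C.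

Definition coercive (R : realType) (n : nat) (S : set 'rV[R]_n)
    (V : 'rV[R]_n -> R) : Prop :=
  forall xs : nat -> 'rV[R]_n, (forall k, S (xs k)) ->
    `|xs k| @[k --> \oo] --> +oo -> V (xs k) @[k --> \oo] --> +oo.

Definition gradient (R : realType) (n : nat) (V : 'rV[R]_n -> R)
    (x : 'rV[R]_n) : 'rV[R]_n :=
  \row_i 'D_(delta_mx 0 i) V x.

Definition continuously_differentiable_on (R : realType) (n : nat)
    (S : set 'rV[R]_n) (V : 'rV[R]_n -> R) : Prop :=
  (forall x, S x -> differentiable V x) /\ {within S, continuous (gradient V)}.

Definition Gamma (R : realType) (z : R) : R :=
  \int[@lebesgue_measure R]_(t in `]0, +oo[) (t `^ (z - 1) * expR (- t)).

Definition settling_gain (R : realType) (alpha beta p q r : R) : R :=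
  Gamma ((1 - r * p) / (q - p)) * Gamma ((r * q - 1) / (q - p))
    / (alpha `^ r * Gamma r * (q - p))
    * (alpha / beta) `^ ((1 - r * p) / (q - p)).

Definition box (R : realType) (n : nat) (a b : 'rV[R]_n) : set 'rV[R]_n :=
  [set x | forall i, a 0 i <= x 0 i <= b 0 i].

Definition box_volume (R : realType) (n : nat) (a b : 'rV[R]_n) : R :=
  \prod_i Num.max 0 (b 0 i - a 0 i).

(* The covers are indexed by an arbitrary set of naturals so that finite covers
   (and the empty one, when n = 0) are allowed. *)
Definition lebesgue_outer (R : realType) (n : nat) (E : set 'rV[R]_n) : \bar R :=
  ereal_inf [set v | exists (I : set nat) (a b : nat -> 'rV[R]_n),
    E `<=` \bigcup_(k in I) box (a k) (b k) /\
    v = (\esum_(k in I) (box_volume (a k) (b k))%:E)%E].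

Definition lebesgue_measurable_on (R : realType) (n m : nat)
    (S : set 'rV[R]_n) (phi : 'rV[R]_n -> 'rV[R]_m) : Prop :=
  forall O : set 'rV[R]_m, open O ->
    (@lebesgue_outer R n).-caratheodory (S `&` phi @^-1` O).

(* A signal [0, oo) -> U is a function on R, of which only the values at t >= 0
   matter; Lebesgue measurability is measurability for the completed Lebesgue
   sigma-algebra, i.e. the Caratheodory sigma-algebra of the length. *)
Definition admissible_signal (R : realType) (m : nat) (U : set 'rV[R]_m)
    (u : R -> 'rV[R]_m) : Prop :=
  (forall t, 0 <= t -> U (u t)) /\
  (forall i, measurable_fun
     (`[0, +oo[ : set (caratheodory_type (wlength (@idfun R))^*%mu))
     (fun t => u t 0 i)).

(* Solutions on [0, oo) of x' = g x are meant in the sense of Caratheodory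
   (absolutely continuous, equation satisfied almost everywhere), i.e. as
   solutions of the integral equation. *)
Definition solution (R : realType) (n : nat) (D : set 'rV[R]_n)
    (g : 'rV[R]_n -> 'rV[R]_n) (x0 : 'rV[R]_n) (x : R -> 'rV[R]_n) : Prop :=
  (forall t, 0 <= t -> D (x t)) /\
  (forall t, 0 <= t -> forall i,
     (@completed_lebesgue_measure R).-integrable `[0, t]
       (fun tau => (g (x tau) 0 i)%:E) /\
     x t 0 i = x0 0 i +
       \int[@completed_lebesgue_measure R]_(tau in `[0, t]) g (x tau) 0 i).

Definition the_solution (R : realType) (n : nat) (D : set 'rV[R]_n)
    (g : 'rV[R]_n -> 'rV[R]_n) (x0 : 'rV[R]_n) (x : R -> 'rV[R]_n) : Prop :=
  solution D g x0 x /\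
  forall y, solution D g x0 y -> forall t, 0 <= t -> y t = x t.

(* dist (x t) S = 0 alone only puts x t in the closure of S, while the running
   cost, the strategies and V live on S: positive invariance of S is included. *)
Definition remains_in (R : realType) (n : nat) (S : set 'rV[R]_n)
    (x : R -> 'rV[R]_n) : Prop :=
  forall t, 0 <= t -> dist (x t) S = 0 /\ S (x t).

Definition safely_predefined_time_stable_with (R : realType) (n N : nat)
    (D S : set 'rV[R]_n) (Tp : R) (f : 'rV[R]_n -> 'rV[R]_N -> 'rV[R]_n)
    (theta : 'rV[R]_N) : Prop :=
  f 0 theta = 0 /\
  forall x0, S x0 -> exists x, [/\ the_solution D (f^~ theta) x0 x,
    remains_in S x & forall t, Tp <= t -> x t = 0].

Definition safely_predefined_time_stable (R : realType) (n N : nat)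
    (D S : set 'rV[R]_n) (Tp : R) (f : 'rV[R]_n -> 'rV[R]_N -> 'rV[R]_n) : Prop :=
  exists theta, safely_predefined_time_stable_with D S Tp f theta.

(* A map S -> U is represented by its extension by 0 (recall 0 \in U) to R^n.
   This makes the representation unique, and makes the closed-loop vector field
   defined on the whole of D. *)
Definition feedback_law (R : realType) (n m : nat) (S : set 'rV[R]_n)
    (U : set 'rV[R]_m) (phi : 'rV[R]_n -> 'rV[R]_m) : Prop :=
  [/\ forall x, S x -> U (phi x), forall x, ~ S x -> phi x = 0,
      lebesgue_measurable_on S phi & phi 0 = 0].

Definition strategy (R : realType) (n m N : nat) (S : set 'rV[R]_n)
    (U : set 'rV[R]_m) (ustar : 'rV[R]_n -> 'rV[R]_N -> 'rV[R]_m) : Prop :=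
  forall theta, feedback_law S U (ustar^~ theta).

Definition feedback_field (R : realType) (n Ns m_u m_a : nat)
    (F : 'rV[R]_n -> 'rV[R]_Ns -> 'rV[R]_m_u -> 'rV[R]_m_a -> 'rV[R]_n)
    (thetas : 'rV[R]_Ns) (phi : 'rV[R]_n -> 'rV[R]_m_u)
    (psi : 'rV[R]_n -> 'rV[R]_m_a) (x : 'rV[R]_n) : 'rV[R]_n :=
  F x thetas (phi x) (psi x).

(* The closed-loop system as a system with parameter (thetas, thetac, thetaa). *)
Definition closed_loop (R : realType) (n Ns Nc Na m_u m_a : nat)
    (F : 'rV[R]_n -> 'rV[R]_Ns -> 'rV[R]_m_u -> 'rV[R]_m_a -> 'rV[R]_n)
    (ustar : 'rV[R]_n -> 'rV[R]_Nc -> 'rV[R]_m_u)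
    (astar : 'rV[R]_n -> 'rV[R]_Na -> 'rV[R]_m_a)
    (x : 'rV[R]_n) (theta : 'rV[R]_(Ns + Nc + Na)) : 'rV[R]_n :=
  feedback_field F (lsubmx (lsubmx theta))
    (ustar^~ (rsubmx (lsubmx theta))) (astar^~ (rsubmx theta)) x.

(* x is the solution of the controlled system generated by the feedback pair
   (phi, psi), the generated signals phi \o x and psi \o x being admissible. *)
Definition feedback_solution (R : realType) (n Ns m_u m_a : nat)
    (D : set 'rV[R]_n) (U : set 'rV[R]_m_u) (A : set 'rV[R]_m_a)
    (F : 'rV[R]_n -> 'rV[R]_Ns -> 'rV[R]_m_u -> 'rV[R]_m_a -> 'rV[R]_n)
    (thetas : 'rV[R]_Ns) (phi : 'rV[R]_n -> 'rV[R]_m_u)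
    (psi : 'rV[R]_n -> 'rV[R]_m_a) (x0 : 'rV[R]_n) (x : R -> 'rV[R]_n) : Prop :=
  [/\ the_solution D (feedback_field F thetas phi psi) x0 x,
      admissible_signal U (phi \o x) & admissible_signal A (psi \o x)].

(* The players choose feedback laws, i.e. u(t) = phi (x t) and a(t) = psi (x t)
   where x is the solution generated by the very pair (phi, psi). *)
Definition stabilizing_pairs (R : realType) (n Ns m_u m_a : nat)
    (D S : set 'rV[R]_n) (U : set 'rV[R]_m_u) (A : set 'rV[R]_m_a) (Tp : R)
    (F : 'rV[R]_n -> 'rV[R]_Ns -> 'rV[R]_m_u -> 'rV[R]_m_a -> 'rV[R]_n)
    (thetas : 'rV[R]_Ns) (x0 : 'rV[R]_n) :
    set (('rV[R]_n -> 'rV[R]_m_u) * ('rV[R]_n -> 'rV[R]_m_a)) :=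
  [set w | [/\ feedback_law S U w.1, feedback_law S A w.2 &
     exists x, [/\ feedback_solution D U A F thetas w.1 w.2 x0 x,
       remains_in S x & forall t, Tp <= t -> x t = 0]]].

Definition trajectory (R : realType) (n : nat) (D : set 'rV[R]_n)
    (g : 'rV[R]_n -> 'rV[R]_n) (x0 : 'rV[R]_n) : R -> 'rV[R]_n :=
  get [set x | the_solution D g x0 x].

(* The cost is extended-real valued since the running cost of an arbitrary
   admissible pair need not be integrable. *)
Definition cost (R : realType) (n Ns m_u m_a : nat) (D : set 'rV[R]_n) (Tp : R)
    (F : 'rV[R]_n -> 'rV[R]_Ns -> 'rV[R]_m_u -> 'rV[R]_m_a -> 'rV[R]_n)
    (rcost : 'rV[R]_n -> 'rV[R]_m_u -> 'rV[R]_m_a -> R)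
    (thetas : 'rV[R]_Ns) (x0 : 'rV[R]_n)
    (phi : 'rV[R]_n -> 'rV[R]_m_u) (psi : 'rV[R]_n -> 'rV[R]_m_a) : \bar R :=
  let x := trajectory D (feedback_field F thetas phi psi) x0 in
  (\int[@completed_lebesgue_measure R]_(t in `[0%R, Tp])
     (rcost (x t) (phi (x t)) (psi (x t)))%:E)%E.

Definition hamiltonian (R : realType) (n Ns m_u m_a : nat)
    (F : 'rV[R]_n -> 'rV[R]_Ns -> 'rV[R]_m_u -> 'rV[R]_m_a -> 'rV[R]_n)
    (rcost : 'rV[R]_n -> 'rV[R]_m_u -> 'rV[R]_m_a -> R)
    (x : 'rV[R]_n) (thetas : 'rV[R]_Ns) (u : 'rV[R]_m_u) (a : 'rV[R]_m_a)
    (lambda : 'rV[R]_n) : R :=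
  rcost x u a + dot lambda (F x thetas u a).

(* J(u, a) = min_X max_Y J = max_Y min_X J. At a strategy other than u (resp. a)
   the inner extremum need not be attained, so it is a supremum (resp. infimum);
   the last clause says that all extrema are attained at (u, a). *)
Definition nash_equilibrium (R : realType) (P Q : Type) (X : set P) (Y : set Q)
    (J : P -> Q -> \bar R) (u : P) (a : Q) : Prop :=
  [/\ X u, Y a,
      J u a = ereal_inf [set ereal_sup [set J u' a' | a' in Y] | u' in X],
      J u a = ereal_sup [set ereal_inf [set J u' a' | u' in X] | a' in Y] &
      (forall a', Y a' -> (J u a' <= J u a)%E) /\
      (forall u', X u' -> (J u a <= J u' a)%E)].

(* Main.v *)
(** Since V blows up at the boundary, S is open, and since V decreases along the
    closed loop, trajectories cannot leave S. The settling time is bounded by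
    separating variables: the gain is exactly the integral over ]0, +oo[ of
    1 / (alpha y^p + beta y^q)^r, a Beta integral computed by Tonelli's theorem.
    Along any stabilizing pair, V (x0) is the integral over [0, Tp] of
    - V'(x) F(x, u, a); the signs of the Hamiltonian then compare the running cost
    with this integrand pointwise, which makes the pair of strategies a saddle
    point of value V (x0). Solutions are only absolutely continuous, so all this
    rests on the chain rule for V along such paths, proved by real induction. *)
Require Import Defs.
From mathcomp Require Import all_boot all_order all_algebra.
From mathcomp Require Import all_classical all_reals all_analysis.
From mathcomp Require Import measurable_realfun ring lra.

Set Implicit Arguments.
Unset Strict Implicit.
Unset Printing Implicit Defensive.

Import Order.TTheory GRing.Theory Num.Theory.
Import numFieldNormedType.Exports.

Local Open Scope classical_set_scope.
Local Open Scope ring_scope.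

(** * The Gamma function and the integral of the inverse decay rate *)

(** Feedback laws are only measurable, so closed-loop fields may be discontinuous, and [V] along a
    solution need not be differentiable in time at a given instant. Every differential inequality is
    therefore used in integrated form. An integrable velocity gives no bound of the increments of a
    path by a multiple of the elapsed time, so the errors in the chain rule are measured against the
    variation of the path instead. Separating variables divides by the decay rate, which vanishes
    with [V]; arguing by contradiction keeps [V] above a positive level up to the final time. The
    saddle point rests on the product structure of the strategy sets: if one player deviates, the
    mixed pair still lies in the product of [Fu x0] and [Fa x0], hence is stabilizing, and its
    trajectory is at 0 at time [Tp]. The integral of - V'(x) F is thus V(x0) for every unilateral
    deviation. The cost of a deviation may fail to be integrable, so it is compared by monotonicity
    of the extended integral alone. *)

Section substitution_powR.
Context {R : realType}.
Notation mu := (@lebesgue_measure R).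

Lemma continuous_pos_measurable_fun (f : R -> R) :
  (forall x : R, 0 < x -> {for x, continuous f}) ->
  measurable_fun (`]0, +oo[ : set R) f.
Proof.
move=> cf; apply: open_continuous_measurable_fun => //.
by move=> x; rewrite inE/= in_itv/= andbT; exact: cf.
Qed.

(** Monotone convergence along an exhaustion by segments, which avoid a possible singularity at
    0. *)
Lemma cvg_integral_itv0y (f : R -> R) (a b : nat -> R) :
  (forall x : R, 0 < x -> {for x, continuous f}) ->
  (forall x : R, 0 < x -> 0 <= f x) ->
  (forall n, 0 < a n) -> nonincreasing_seq a -> a @ \oo --> 0 ->
  nondecreasing_seq b -> b @ \oo --> +oo ->
  (\int[mu]_(x in `[a n, b n]) (f x)%:E @[n --> \oo] -->
    \int[mu]_(x in `]0%R, +oo[) (f x)%:E)%E.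
Proof.
move=> cf f0 a_gt0 a_ni a0 b_nd b_y.
have UE : \bigcup_n `[a n, b n]%classic = `]0, +oo[%classic :> set R.
  apply/seteqP; split => x /=.
    by move=> [n _]; rewrite /= !in_itv/= andbT => /andP[+ _]; exact: lt_le_trans.
  rewrite in_itv/= andbT => x0.
  have : \forall n \near \oo, a n <= x /\ x <= b n.
    near=> n; split.
      near: n; apply: (cvgr_le 0) => //.
    near: n; move/cvgryPge : b_y; exact.
  move=> [n _ /(_ n (leqnn _))[an bn]].
  by exists n => //=; rewrite in_itv/= an bn.
rewrite -UE.
apply: (@ge0_nondecreasing_set_cvg_integral _ (measurableTypeR R) R
  (fun n => `[a n, b n]%classic) (EFin \o f) mu).
- move=> m n mn; apply/subsetPset => x /=; rewrite !in_itv/= => /andP[ax xb].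
  rewrite (le_trans (a_ni _ _ mn) ax)/=; exact: le_trans (b_nd _ _ mn).
- by move=> n; exact: measurable_itv.
- move=> n; apply/measurable_EFinP.
  apply: measurable_funS (continuous_pos_measurable_fun cf) => //.
  by rewrite -UE => x ?; exists n.
- move=> n x /=; rewrite in_itv/= => /andP[ax _]; rewrite lee_fin f0//.
  exact: lt_le_trans ax.
Unshelve. all: by end_near. Qed.

Lemma continuous_powR_gt0 (k x : R) : 0 < x -> {for x, continuous (@powR R ^~ k)}.
Proof.
move=> x0; apply/differentiable_continuous/derivable1_diffP.
by apply: derivable_powR; rewrite in_itv/= x0.
Qed.

Lemma ge0_integral_scaled_powR (c k : R) (G : R -> R) : 0 < c -> 0 < k ->
  (forall x : R, 0 < x -> {for x, continuous G}) ->
  (forall x : R, 0 < x -> 0 <= G x) ->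
  (\int[mu]_(x in `]0%R, +oo[) (G x)%:E =
   \int[mu]_(x in `]0%R, +oo[) (G (c * x `^ k) * (c * k * x `^ (k - 1)))%:E)%E.
Proof.
move=> c0 k0 cG G0.
pose F x := c * x `^ k.
have F_gt0 (x : R) : 0 < x -> 0 < F x by move=> x0; rewrite mulr_gt0 ?powR_gt0.
have dF (x : R) : 0 < x -> is_derive x 1 F (c * k * x `^ (k - 1)).
  move=> x0; have ? := is_derive1_powR k x0.
  by apply: is_derive_eq; rewrite -mulrA.
have F'E (x : R) : 0 < x -> F^`()%classic x = c * k * x `^ (k - 1).
  by move=> x0; rewrite derive1E; have [_ ->] := dF _ x0.
have cF (x : R) : 0 < x -> {for x, continuous F}.
  move=> x0; apply/differentiable_continuous/derivable1_diffP.
  by have [] := dF _ x0.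
have cF' (x : R) : 0 < x -> {for x, continuous F^`()%classic}.
  move=> x0; rewrite /prop_for /continuous_at F'E//.
  have : (c * k * y `^ (k - 1)) @[y --> x] --> c * k * x `^ (k - 1).
    by apply: cvgMr; exact: continuous_powR_gt0.
  apply: cvg_trans; apply: near_eq_cvg; near=> y.
  rewrite F'E//; near: y; exact: lt_nbhsr.
have Fincr : {in Num.pos &, {homo F : x y / x < y}}.
  move=> x y; rewrite !posrE => x0 y0 xy; rewrite /F ltr_pM2l//.
  by rewrite gt0_ltr_powR// ?nnegrE ltW.
have nat_gt0 n : 0 < (n.+1%:R : R) by rewrite ltr0n.
pose a n : R := n.+1%:R^-1; pose b n : R := n.+1%:R.
have a_gt0 n : 0 < a n by rewrite invr_gt0.
have b_gt0 n : 0 < b n by [].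
have a_ni : nonincreasing_seq a.
  by move=> m n mn; rewrite /a lef_pV2// ?posrE// ler_nat.
have b_nd : nondecreasing_seq b by move=> m n mn; rewrite /b ler_nat.
have a0 : a @ \oo --> 0 by exact: cvg_harmonic.
have b_y : b @ \oo --> +oo.
  apply/cvgryPge => M; near=> n.
  by rewrite /b (@le_trans _ _ n%:R)// ?ler_nat//; near: n; exact: nbhs_infty_ger.
have cGFF' (x : R) : 0 < x ->
    {for x, continuous (fun x => G (F x) * (c * k * x `^ (k - 1)))}.
  move=> x0; apply: cvgM; last by apply: cvgMr; exact: continuous_powR_gt0.
  by apply: (@continuous_comp _ _ _ F G); [exact: cF|exact/cG/F_gt0].
have cvgR : (\int[mu]_(x in `[a n, b n])
      (G (F x) * (c * k * x `^ (k - 1)))%:E @[n --> \oo] -->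
    \int[mu]_(x in `]0%R, +oo[) (G (F x) * (c * k * x `^ (k - 1)))%:E)%E.
  apply: cvg_integral_itv0y => // x x0.
  by rewrite mulr_ge0 ?G0 ?F_gt0// mulr_ge0 ?powR_ge0// mulr_ge0// ltW.
have cvgL : (\int[mu]_(x in `[F (a n), F (b n)]) (G x)%:E @[n --> \oo] -->
    \int[mu]_(x in `]0%R, +oo[) (G x)%:E)%E.
  apply: (@cvg_integral_itv0y G (F \o a) (F \o b)) => //.
  - by move=> n; exact: F_gt0.
  - move=> m n mn; rewrite /F/= ler_pM2l//.
    rewrite ge0_ler_powR ?nnegrE ?(ltW k0) ?(ltW (a_gt0 _))//.
    exact: a_ni.
  - rewrite -(mulr0 c); apply: cvgMr.
    by have /cvg_at_rightP/(_ a) := powR_cvg0 k0; apply.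
  - move=> m n mn; rewrite /F/= ler_pM2l//.
    rewrite ge0_ler_powR ?nnegrE ?(ltW k0) ?(ltW (b_gt0 _))//.
    exact: b_nd.
  - apply/cvgryPge => M; near=> n => /=.
    rewrite /F (@le_trans _ _ (c * (`|M| / c)))//.
      by rewrite mulrC divfK ?gt_eqF// ler_norm.
    rewrite ler_pM2l//.
    (* It suffices that [b n] exceed the [k]-th root of [|M| / c]. *)
    rewrite -[leLHS]powRr1 ?divr_ge0// ?(ltW c0)// -(@mulVf _ k) ?gt_eqF// powRrM.
    rewrite ge0_ler_powR ?(ltW k0) ?nnegrE ?powR_ge0//.
    by near: n; move/cvgryPge : b_y; exact.
rewrite -(cvg_lim _ cvgL)// -(cvg_lim _ cvgR)//.
congr (limn _); apply/funext => n.
have anbn : a n <= b n by rewrite /a /b (@le_trans _ _ 1)// ?invf_le1// ler1n.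
rewrite (@integration_by_substitution_increasing _ F G)//.
- apply: eq_integral => x; rewrite inE/= in_itv/= => /andP[ax _].
  by rewrite /= fctE F'E//; exact: lt_le_trans ax.
- move=> x y; rewrite !in_itv/= => /andP[ax _] /andP[ay _]; apply: Fincr.
  + by rewrite posrE (lt_le_trans _ ax).
  + by rewrite posrE (lt_le_trans _ ay).
- by move=> x; rewrite in_itv/= => /andP[ax _]; apply: cF'; rewrite (lt_trans _ ax).
- by apply/cvg_ex; eexists; apply: cvg_at_right_filter; apply: cF'.
- by apply/cvg_ex; eexists; apply: cvg_at_left_filter; apply: cF'.
- split.
  + move=> x; rewrite in_itv/= => /andP[ax _].
    by have [] := dF x (lt_trans (a_gt0 n) ax).
  + by apply: cvg_at_right_filter; apply: cF.
  + by apply: cvg_at_left_filter; apply: cF.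
- apply: continuous_in_subspaceT => x; rewrite inE/= in_itv/= => /andP[ax _].
  by apply: cG; rewrite (lt_le_trans _ ax)// F_gt0.
Unshelve. all: by end_near.
Qed.
End substitution_powR.

Section Gamma_integrals.
Context {R : realType}.
Notation mu := (@lebesgue_measure R).

Lemma continuous_expRN (x : R) : {for x, continuous (fun t : R => expR (- t))}.
Proof.
by apply: continuous_comp; [exact: opp_continuous|exact: continuous_expR].
Qed.

Lemma continuous_expRN_powR (c k x : R) : 0 < x ->
  {for x, continuous (fun t : R => expR (- (c * t `^ k)))}.
Proof.
move=> x0.
apply: (@continuous_comp _ _ _ (fun t : R => c * t `^ k) (fun t : R => expR (- t))).
  by apply: cvgMr; exact: continuous_powR_gt0.
exact: continuous_expRN.
Qed.

Lemma measurable_expRMN (c : R) (D : set R) :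
  measurable_fun D (fun x : R => c * expR (- c * x)).
Proof.
apply: measurable_funTS; apply: continuous_measurable_fun => x.
apply: cvgMr; apply: (@continuous_comp _ _ _ (fun x : R => - c * x) expR).
  exact: mulrl_continuous.
exact: continuous_expR.
Qed.

Lemma integral_expRMN (c : R) : 0 < c ->
  (\int[mu]_(x in `]0%R, +oo[) (c * expR (- c * x))%:E = 1)%E.
Proof.
move=> c0; rewrite integral_itv_obnd_cbnd; last first.
  by apply/measurable_EFinP; exact: measurable_expRMN.
rewrite -(integral_exponential_pdf c0) integral_mkcond; apply: eq_integral => x _.
by rewrite /exponential_pdf restrict_EFin.
Qed.

(* From 1 + t / (2 m) <= expR (t / (2 m)). *)
Lemma powR_le_expR (m t : R) : 0 < m -> 0 < t ->
  t `^ m <= (2 * m) `^ m * expR (t / 2).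
Proof.
move=> m0 t0.
have -> : t / 2 = t / (2 * m) * m by field; lra.
rewrite expRM -powRM ?expR_ge0 ?mulr_ge0 ?(ltW m0)//.
rewrite ge0_ler_powR ?(ltW m0) ?nnegrE ?mulr_ge0 ?expR_ge0 ?(ltW m0) ?(ltW t0)//.
rewrite -ler_pdivrMl ?mulr_gt0// mulrC.
by apply: le_trans (expR_ge1Dx _); rewrite lerDr.
Qed.

(* Both terms of the bound integrate in closed form: the first one, which
   controls the singularity at 0, is the derivative of a function of t `^ z. *)
Lemma Gamma_integrand_le (z t : R) : 0 < z -> 0 < t ->
  t `^ (z - 1) * expR (- t) <=
  expR (z^-1) * (expR (- (z^-1 * t `^ z)) * (z^-1 * z * t `^ (z - 1))) +
  (2 * z) `^ z * 2 * (2^-1 * expR (- 2^-1 * t)).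
Proof.
move=> z0 t0; rewrite mulVf ?gt_eqF// mul1r.
have C0 : 0 <= (2 * z) `^ z * 2 * (2^-1 * expR (- 2^-1 * t)).
  by rewrite !mulr_ge0 ?powR_ge0 ?expR_ge0.
have C1 : 0 <= expR z^-1 * (expR (- (z^-1 * t `^ z)) * t `^ (z - 1)).
  by rewrite !mulr_ge0 ?powR_ge0 ?expR_ge0.
(* Up to 1 the first term suffices, the factor [expR z^-1] compensating the smallest value of the
   exponential. Beyond 1 the second term does, since there t^(z-1) <= t^z. *)
have [t1|t1] := leP t 1.
  apply: le_trans (_ : t `^ (z - 1) <= _).
    by rewrite ler_piMr ?powR_ge0// -expR0 ler_expR oppr_le0 ltW.
  apply: ler_wpDr => //; rewrite mulrA -expRD ler_peMl ?powR_ge0//.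
  rewrite -expR0 ler_expR subr_ge0 ler_piMr ?invr_ge0 ?(ltW z0)//.
  have := @ge0_ler_powR _ z (ltW z0) t 1.
  by rewrite powR1 !nnegrE; apply => //; exact: ltW.
apply: ler_wpDl => //.
have -> : (2 * z) `^ z * 2 * (2^-1 * expR (- 2^-1 * t)) =
          ((2 * z) `^ z * expR (t / 2)) * expR (- t).
  rewrite -!mulrA -expRD mulVKf //; congr (_ * expR _); lra.
rewrite ler_wpM2r ?expR_ge0//.
apply: le_trans (powR_le_expR z0 t0).
by apply: ler_powR; [exact: ltW|lra].
Qed.

Lemma measurable_Gamma_integrand (z : R) :
  measurable_fun (`]0, +oo[ : set R) (fun t : R => t `^ (z - 1) * expR (- t)).
Proof.
apply: continuous_pos_measurable_fun => x x0.
by apply: cvgM; [exact: continuous_powR_gt0|exact: continuous_expRN].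
Qed.

(** [Gamma] is a real-valued integral, hence 0 by default if the extended one is infinite; the
    content is finiteness. *)
Lemma GammaE (z : R) : 0 < z ->
  (\int[mu]_(t in `]0%R, +oo[) (t `^ (z - 1) * expR (- t))%:E = (Gamma z)%:E)%E.
Proof.
move=> z0.
have I0 : (0 <= \int[mu]_(t in `]0%R, +oo[) (t `^ (z - 1) * expR (- t))%:E)%E.
  by apply: integral_ge0 => x _; rewrite lee_fin mulr_ge0 ?powR_ge0 ?expR_ge0.
suff fin : (\int[mu]_(t in `]0%R, +oo[) (t `^ (z - 1) * expR (- t))%:E < +oo)%E.
  by rewrite /Gamma /Rintegral fineK// ge0_fin_numE.
pose f1 (t : R) := expR (- (z^-1 * t `^ z)) * (z^-1 * z * t `^ (z - 1)).
pose f2 (t : R) := 2^-1 * expR (- 2^-1 * t).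
(* With w = t^z / z, [f1] becomes the exponential density of rate 1. *)
have int1 : (\int[mu]_(t in `]0%R, +oo[) (f1 t)%:E = 1)%E.
  rewrite -(@ge0_integral_scaled_powR _ z^-1 z (fun w => expR (- w))) ?invr_gt0//.
  - rewrite -(@integral_expRMN 1)//; apply: eq_integral => t _.
    by rewrite mul1r mulN1r.
  - by move=> x _; exact: continuous_expRN.
have int2 : (\int[mu]_(t in `]0%R, +oo[) (f2 t)%:E = 1)%E.
  exact: integral_expRMN.
have f1_ge0 x : 0 <= f1 x.
  by rewrite !mulr_ge0 ?powR_ge0 ?expR_ge0 ?invr_ge0 ?(ltW z0).
have f2_ge0 x : 0 <= f2 x by rewrite !mulr_ge0 ?expR_ge0.
have mf1 : measurable_fun (`]0, +oo[ : set R) f1.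
  apply: continuous_pos_measurable_fun => x x0.
  apply: cvgM; first exact: continuous_expRN_powR.
  by apply: cvgMr; exact: continuous_powR_gt0.
have mf2 : measurable_fun (`]0, +oo[ : set R) f2.
  exact: measurable_expRMN.
apply: (@le_lt_trans _ _ (\int[mu]_(t in `]0%R, +oo[)
    ((expR z^-1)%:E * (f1 t)%:E + ((2 * z) `^ z * 2)%:E * (f2 t)%:E))%E).
  apply: ge0_le_integral => //.
  - by move=> x _; rewrite lee_fin mulr_ge0 ?powR_ge0 ?expR_ge0.
  - by apply/measurable_EFinP; exact: measurable_Gamma_integrand.
  - by apply/measurable_EFinP; apply: measurable_funD; apply: measurable_funM.
  - move=> x; rewrite /= in_itv/= andbT => x0; rewrite -!EFinM -EFinD lee_fin.
    exact: Gamma_integrand_le.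
have c1 : 0 <= expR z^-1 :> R by exact: expR_ge0.
have c2 : 0 <= (2 * z) `^ z * 2 by rewrite mulr_ge0 ?powR_ge0.
rewrite ge0_integralD//.
- rewrite !ge0_integralZl_EFin//; try exact/measurable_EFinP.
  + by rewrite int1 int2 !mule1 -EFinD ltry.
  + by move=> x _; rewrite lee_fin.
  + by move=> x _; rewrite lee_fin.
- by move=> x _; rewrite -EFinM lee_fin mulr_ge0.
- by apply/measurable_EFinP; apply: measurable_funM.
- by move=> x _; rewrite -EFinM lee_fin mulr_ge0.
- by apply/measurable_EFinP; apply: measurable_funM.
Qed.

(** On [1, 2] the integrand is at least exp(-2) / 2, because z > 0 gives t^(z-1) >= 1/t >= 1/2. *)
Lemma Gamma_gt0 (z : R) : 0 < z -> 0 < Gamma z.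
Proof.
move=> z0; rewrite -lte_fin -GammaE//.
apply: (@lt_le_trans _ _ (\int[mu]_(t in `[1%R, 2%R]) (2^-1 * expR (- 2))%:E)%E).
  rewrite integral_cst//= lebesgue_measure_itv/= lte_fin ltr1n.
  by rewrite -EFinB -EFinM lte_fin !mulr_gt0 ?expR_gt0//; lra.
apply: (@le_trans _ _
  (\int[mu]_(t in `[1%R, 2%R]) (t `^ (z - 1) * expR (- t))%:E)%E).
  have sub : `[1, 2]%classic `<=` (`]0, +oo[%classic : set R).
    by move=> x /=; rewrite !in_itv/= andbT => /andP[+ _]; apply: lt_le_trans.
  apply: ge0_le_integral => //.
  - apply/measurable_EFinP.
    by apply: measurable_funS (measurable_Gamma_integrand z).
  - move=> x /=; rewrite in_itv/= => /andP[x1 x2].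
    rewrite lee_fin ler_pM ?expR_ge0//.
      apply: (@le_trans _ _ (x `^ (-1))).
        by rewrite powR_inv1 ?lef_pV2 ?posrE//; lra.
      by apply: ler_powR => //; lra.
    by rewrite ler_expR lerN2.
apply: ge0_subset_integral => //.
- by apply/measurable_EFinP; exact: measurable_Gamma_integrand.
- by move=> x _; rewrite lee_fin mulr_ge0 ?powR_ge0 ?expR_ge0.
- by move=> x /=; rewrite !in_itv/= andbT => /andP[+ _]; apply: lt_le_trans.
Qed.

(** Substitute w = c y^k in the integral defining [Gamma (m / k)]. *)
Lemma integral_powR_expR (m c k : R) : 0 < m -> 0 < c -> 0 < k ->
  (\int[mu]_(y in `]0%R, +oo[) (y `^ (m - 1) * expR (- (c * y `^ k)))%:E =
   (k^-1 * c `^ (- (m / k)) * Gamma (m / k))%:E)%E.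
Proof.
move=> m0 c0 k0.
have mk0 : 0 < m / k by rewrite divr_gt0.
have cG (x : R) : 0 < x ->
    {for x, continuous (fun w : R => w `^ (m / k - 1) * expR (- w))}.
  by move=> x0; apply: cvgM; [exact: continuous_powR_gt0|exact: continuous_expRN].
pose g y := y `^ (m - 1) * expR (- (c * y `^ k)).
have g_ge0 y : 0 <= g y by rewrite mulr_ge0 ?powR_ge0 ?expR_ge0.
have E : ((Gamma (m / k))%:E =
    (k * c `^ (m / k))%:E * \int[mu]_(y in `]0%R, +oo[) (g y)%:E)%E.
  rewrite -GammaE// (ge0_integral_scaled_powR c0 k0 cG); last first.
    by move=> x _; rewrite mulr_ge0 ?powR_ge0 ?expR_ge0.
  rewrite -ge0_integralZl_EFin//; last 3 first.
  - by move=> x _; rewrite lee_fin.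
  - apply/measurable_EFinP; apply: continuous_pos_measurable_fun => x x0.
    by apply: cvgM; [exact: continuous_powR_gt0|exact: continuous_expRN_powR].
  - by rewrite mulr_ge0 ?powR_ge0 ?(ltW k0).
  apply: eq_integral => y; rewrite inE/= in_itv/= andbT => y0.
  rewrite -EFinM; congr (_%:E); rewrite /g.
  rewrite powRM ?powR_ge0 ?(ltW c0)// -powRrM.
  have -> : k * (m / k - 1) = m - k by field; exact: lt0r_neq0.
  have -> : c `^ (m / k) = c `^ (m / k - 1) * c.
    by rewrite [RHS]mulrC mulr_powRB1// ltW.
  have -> : m - 1 = (m - k) + (k - 1) by ring.
  have -> : y `^ (m - k + (k - 1)) = y `^ (m - k) * y `^ (k - 1).
    by rewrite powRD// (gt_eqF y0) implybT.
  ring.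
have kc0 : k * c `^ (m / k) != 0 by rewrite gt_eqF// mulr_gt0 ?powR_gt0.
rewrite [RHS](_ : _ = ((k * c `^ (m / k))^-1)%:E * (Gamma (m / k))%:E)%E;
  last first.
  by rewrite -EFinM powRN invfM.
by rewrite E muleA -EFinM mulVf// mul1e.
Qed.

End Gamma_integrals.

Section rate_integral.
Context {R : realType}.
Notation mu := (@lebesgue_measure R).

Lemma integral_powR_expRZ (A m c k : R) : 0 <= A -> 0 < m -> 0 < c -> 0 < k ->
  (\int[mu]_(y in `]0%R, +oo[) (A * (y `^ (m - 1) * expR (- (c * y `^ k))))%:E =
   (A * (k^-1 * c `^ (- (m / k)) * Gamma (m / k)))%:E)%E.
Proof.
move=> A0 m0 c0 k0; under eq_integral do rewrite EFinM.
rewrite ge0_integralZl_EFin//; last 2 first.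
- by move=> x _; rewrite lee_fin mulr_ge0 ?powR_ge0 ?expR_ge0.
- apply/measurable_EFinP; apply: continuous_pos_measurable_fun => x x0.
  by apply: cvgM; [exact: continuous_powR_gt0|exact: continuous_expRN_powR].
by rewrite integral_powR_expR.
Qed.

(** Puts the domain into the integrand, so that Tonelli applies to a function on the whole plane. *)
Lemma integral_itv0y_indic (g : R -> R) :
  (\int[mu]_(x in `]0%R, +oo[) (g x)%:E =
   \int[mu]_x (\1_(`]0%R, +oo[) x * g x)%:E)%E.
Proof.
rewrite integral_mkcond; apply: eq_integral => x _.
by rewrite patchE indicE; case: (x \in _); rewrite ?mul1r ?mul0r.
Qed.

Lemma eq_EFin_div (x : \bar R) (c d : R) : 0 < c ->
  (c%:E * x = d%:E)%E -> x = (c^-1 * d)%:E.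
Proof.
by move=> c0 xd; rewrite EFinM -xd muleA -EFinM mulVf ?mul1e// lt0r_neq0.
Qed.

(** The left side is what the double integral yields after division by [Gamma r]; with [a + b = r]
    the right side is [settling_gain]. *)
Lemma settling_gain_algebra (alpha beta a b k Ga Gb Gr : R) :
  0 < alpha -> 0 < beta -> 0 < k -> 0 < Gr ->
  Gr^-1 * ((k^-1 * beta `^ (- a) * Ga) * (alpha `^ (- b) * Gb)) =
  Ga * Gb / (alpha `^ (a + b) * Gr * k) * (alpha / beta) `^ a.
Proof.
move=> al0 be0 k0 Gr0.
rewrite powRM ?invr_ge0 ?(ltW al0) ?(ltW be0)//.
rewrite -[beta^-1]powR_inv1 ?(ltW be0)// -powRrM mulN1r.
have -> : alpha `^ a = alpha `^ (a + b) * alpha `^ (- b).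
  by rewrite -powRD ?(gt_eqF al0) ?implybT//; congr (_ `^ _); ring.
by field; rewrite !lt0r_neq0 ?powR_gt0.
Qed.

(* With h y = alpha y^p + beta y^q, write Gamma r * h(y)^(-r) as the integral of
   t^(r - 1) exp(- t h(y) y^(-p)) y^(-pr) over t > 0 and integrate in y first. *)
Lemma integral_inv_rate (alpha beta p q r : R) :
  0 < alpha -> 0 < beta -> 0 < p -> 0 < q -> 0 < r -> p * r < 1 -> 1 < q * r ->
  (\int[mu]_(y in `]0%R, +oo[) (((alpha * y `^ p + beta * y `^ q) `^ r)^-1)%:E =
   (settling_gain alpha beta p q r)%:E)%E.
Proof.
move=> al0 be0 p0 q0 r0 pr1 qr1.
have k0 : 0 < q - p.
  by rewrite subr_gt0 -(ltr_pM2r r0) (lt_trans pr1).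
set k := q - p in k0 *.
(* Integrating y^(-rp) exp(- beta t y^k) in y produces [Gamma a] and a factor t^(-a). The remaining
   power of t is r - 1 - a = b - 1, whence [Gamma b]. *)
pose a := (1 - r * p) / k; pose b := (r * q - 1) / k.
have m0 : 0 < 1 - r * p by rewrite subr_gt0 mulrC.
have a0 : 0 < a by rewrite divr_gt0.
have b0 : 0 < b by rewrite divr_gt0// subr_gt0 mulrC.
have ab : r = a + b.
  by rewrite /a /b /k; field; rewrite /k in k0; exact: lt0r_neq0.
pose h y := (alpha * y `^ p + beta * y `^ q) `^ r.
pose i (x : R) : R := \1_(`]0%R, +oo[) x.
have i_pos (x : R) : 0 < x -> i x = 1.
  by move=> x0; rewrite /i indicE mem_set//= in_itv/= x0.
have i_npos (x : R) : ~~ (0 < x) -> i x = 0.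
  by move=> x0; rewrite /i indicE memNset//= in_itv/= andbT; apply/negP.
have i_ge0 x : 0 <= i x by rewrite /i.
have mi : measurable_fun setT i by exact: measurable_indic.
pose f (z : R * R) := (i z.1 * z.1 `^ (- (r * p))) * (i z.2 * z.2 `^ (r - 1))
   * expR (- (alpha * z.2 + beta * z.2 * z.1 `^ k)).
have f_ge0 z : 0 <= f z by rewrite !mulr_ge0 ?powR_ge0 ?expR_ge0.
have mi1 : measurable_fun setT (fun z : R * R => i z.1).
  exact: measurableT_comp mi measurable_fst.
have mi2 : measurable_fun setT (fun z : R * R => i z.2).
  exact: measurableT_comp mi measurable_snd.
have mp1 e : measurable_fun setT (fun z : R * R => z.1 `^ e).
  exact: measurableT_comp (measurable_powR e) measurable_fst.
have mp2 e : measurable_fun setT (fun z : R * R => z.2 `^ e).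
  exact: measurableT_comp (measurable_powR e) measurable_snd.
have mZ2 c : measurable_fun setT (fun z : R * R => c * z.2).
  by apply: measurable_funM => //; exact: measurable_snd.
have mf : measurable_fun setT f.
  apply: measurable_funM.
    by apply: measurable_funM; apply: measurable_funM.
  apply: measurableT_comp; first exact: measurable_expR.
  apply: measurableT_comp => //.
  apply: measurable_funD => //; exact: measurable_funM.
have EL : (\int[mu]_y \int[mu]_t (f (y, t))%:E =
    (Gamma r)%:E * \int[mu]_(y in `]0%R, +oo[) (h y)^-1%:E)%E.
  rewrite -ge0_integralZl_EFin//; last 3 first.
  - by move=> x _; rewrite lee_fin invr_ge0 powR_ge0.
  - apply/measurable_EFinP; apply: measurable_funTS.
    under eq_fun do rewrite -powRN.
    apply: (@measurableT_comp _ _ _ _ _ _ (fun x : R => x `^ (- r))).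
      exact: measurable_powR.
    apply: measurable_funD; apply: measurable_funM => //; exact: measurable_powR.
  - exact/ltW/Gamma_gt0.
  under [RHS]eq_integral do rewrite -EFinM.
  rewrite integral_itv0y_indic; apply: eq_integral => y _; rewrite -/(i y).
  have [y0|y0] := boolP (0 < y); last first.
    rewrite i_npos// mul0r integral0_eq// => t _.
    by rewrite /f/= i_npos// !mul0r.
  rewrite i_pos// mul1r.
  (* Factoring y^p out of the rate gives [h y] = y^(rp) c^r; the integral in t then contributes
     [Gamma r] c^(-r). *)
  pose c := alpha + beta * y `^ k.
  have c0 : 0 < c by rewrite addr_gt0// mulr_gt0// powR_gt0.
  transitivity (\int[mu]_t (i t * (y `^ (- (r * p)) *
      (t `^ (r - 1) * expR (- (c * t `^ 1)))))%:E)%E.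
    apply: eq_integral => t _; congr (_%:E); rewrite /f/= i_pos// mul1r.
    have [t0|t0] := boolP (0 < t); last by rewrite i_npos//; ring.
    rewrite powRr1 ?(ltW t0)//.
    have -> : alpha * t + beta * t * y `^ k = c * t by rewrite /c; ring.
    ring.
  rewrite -integral_itv0y_indic integral_powR_expRZ ?powR_ge0//.
  congr (_%:E); rewrite !divr1 invr1 mul1r.
  have -> : h y = y `^ (r * p) * c `^ r.
    rewrite /h [r * p]mulrC powRrM -powRM ?powR_ge0 ?(ltW c0)//; congr (_ `^ r).
    rewrite /c mulrDr mulrCA -powRD; last by rewrite (gt_eqF y0) implybT.
    by congr (_ + beta * _ `^ _); [exact: mulrC|rewrite /k; ring].
  by rewrite !powRN invfM; ring.
have ER : (\int[mu]_t \int[mu]_y (f (y, t))%:E =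
    ((k^-1 * beta `^ (- a) * Gamma a) * (alpha `^ (- b) * Gamma b))%:E)%E.
  have A0 : 0 <= k^-1 * beta `^ (- a) * Gamma a.
    by rewrite !mulr_ge0 ?powR_ge0 ?invr_ge0 ?(ltW k0)// ltW// Gamma_gt0.
  (* The outer integral in t is again of Gamma type, of order [b], with inner exponent 1. *)
  have := integral_powR_expRZ A0 b0 al0 ltr01.
  rewrite !divr1 invr1 mul1r => <-.
  rewrite integral_itv0y_indic; apply: eq_integral => t _; rewrite -/(i t).
  have [t0|t0] := boolP (0 < t); last first.
    rewrite i_npos// mul0r integral0_eq// => y _.
    by rewrite /f/= (i_npos t)// mul0r mulr0 mul0r.
  rewrite i_pos// mul1r.
  transitivity (\int[mu]_y (i y * ((t `^ (r - 1) * expR (- (alpha * t))) *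
      (y `^ ((1 - r * p) - 1) * expR (- (beta * t * y `^ k)))))%:E)%E.
    apply: eq_integral => y _; congr (_%:E); rewrite /f/= (i_pos t)// mul1r.
    rewrite opprD expRD (_ : 1 - r * p - 1 = - (r * p)); last by ring.
    ring.
  rewrite -integral_itv0y_indic.
  rewrite integral_powR_expRZ ?mulr_ge0 ?powR_ge0 ?expR_ge0 ?mulr_gt0//.
  rewrite -/a; congr (_%:E); rewrite powRr1 ?(ltW t0)//.
  rewrite powRM ?(ltW t0) ?(ltW be0)//.
  have -> : t `^ (b - 1) = t `^ (r - 1) * t `^ (- a).
    by rewrite -powRD ?(gt_eqF t0) ?implybT//; congr (_ `^ _); rewrite ab; ring.
  ring.
have FT : (\int[mu]_y \int[mu]_t (f (y, t))%:E =
    \int[mu]_t \int[mu]_y (f (y, t))%:E)%E.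
  apply: (@fubini_tonelli _ _ _ _ R mu mu (EFin \o f)).
    exact/measurable_EFinP.
  by move=> z; rewrite lee_fin.
have E := etrans (esym EL) (etrans FT ER).
have Gr0 := Gamma_gt0 r0.
have C := settling_gain_algebra a b (Gamma a) (Gamma b) al0 be0 k0 Gr0.
rewrite -ab in C.
by apply: etrans (eq_EFin_div Gr0 E) _; congr (_%:E); exact: C.
Qed.

End rate_integral.

(** * Indefinite integrals for the completed Lebesgue measure *)

Section completed_measurability.
Context {R : realType}.
Notation cmu := (@completed_lebesgue_measure R).
Notation cR := (caratheodory_type ((wlength (@idfun R))^*)%mu).

Lemma measurable_completed (A : set R) : measurable A -> measurable (A : set cR).
Proof. exact: sub_caratheodory. Qed.

Lemma measurable_fun_completed (A : set R) (f : R -> R) :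
  measurable A -> measurable_fun A f -> measurable_fun (A : set cR) f.
Proof. by move=> mA mf _ B mB; apply: measurable_completed; exact: mf. 
Qed.

Lemma measurable_itv_completed (i : interval R) : measurable ([set` i] : set cR).
Proof. by apply: measurable_completed; exact: measurable_itv. Qed.

(** Half-open intervals concatenate disjointly, so increments are integrals over []s, t]]. For t <=
    0 the interval is empty and the value is 0. *)
Definition integral_from0 (f : R -> R) (t : R) : R :=
  \int[cmu]_(x in `]0, t]) f x.

End completed_measurability.

#[local] Hint Extern 0 (measurable _) =>
  solve [exact: measurable_itv_completed] : core.

(* Real induction: no differentiability is required of phi. *)
Lemma nonincreasing_of_local (R : realType) (phi : R -> R) (T : R) : 0 <= T ->
  (forall s, 0 <= s <= T -> {for s, continuous phi}) ->
  (forall s, 0 <= s < T -> \forall t \near s^'+, phi t <= phi s) ->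
  phi T <= phi 0.
Proof.
move=> T0 cphi loc.
pose E := [set t | 0 <= t <= T /\ phi t <= phi 0].
have E0 : E 0 by split; rewrite ?lexx.
have supE : has_sup E by split; [exists 0|exists T => x [/andP[_ ?] _]].
set s := sup E.
have s0 : 0 <= s by apply: ub_le_sup => //; case: supE.
have sT : s <= T by apply: ge_sup; [exists 0|move=> x [/andP[]]].
have phis : phi s <= phi 0.
  rewrite leNgt; apply/negP => phi0s.
  have : \forall t \near s, phi 0 < phi t.
    have := cphi s; rewrite s0 sT => /(_ isT) c.
    exact: (cvgr_gt (phi s) c _ phi0s).
  move=> /nbhs_ballP[e /= e0 eP].
  have [x Ex sx] := sup_adherent e0 supE.
  have xs : x <= s by apply: ub_le_sup => //; case: supE.
  have : phi 0 < phi x.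
    by apply: eP; rewrite -ball_normE/= ltr_distlC sx (le_lt_trans xs) ?ltrDl.
  by case: Ex => _ Ex; rewrite ltNge Ex.
move: sT; rewrite le_eqVlt => /predU1P[<-//|sT].
exfalso.
(* Local decrease to the right of [s] puts points beyond the supremum into [E]. *)
have : \forall t \near s^'+, E t.
  near=> t; split; last first.
    by apply: le_trans phis; near: t; apply: loc; rewrite s0 sT.
  apply/andP; split.
    by rewrite (le_trans s0)// ltW//; near: t; exact: nbhs_right_gt.
  near: t; exact: nbhs_right_le.
move=> Es.
have [t [Et st]] : exists t, E t /\ s < t.
  near s^'+ => t; exists t; split; near: t => //; exact: nbhs_right_gt.
have : t <= s by apply: ub_le_sup => //; case: supE.
by rewrite leNgt st.
Unshelve. all: by end_near. Qed.

Section integral_from0.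
Context {R : realType}.
Notation cmu := (@completed_lebesgue_measure R).
Notation cR := (caratheodory_type ((wlength (@idfun R))^*)%mu).


Lemma integral_from0B (f : R -> R) (s t : R) : cmu.-integrable setT (EFin \o f) ->
  0 <= s <= t ->
  integral_from0 f t - integral_from0 f s = \int[cmu]_(x in `]s, t]) f x.
Proof.
move=> fi /andP[s0 st].
have : cmu.-integrable `]0, t] (EFin \o f) by exact: integrableS fi.
rewrite /integral_from0 (@itv_bndbnd_setU _ _ _ (BRight s)) ?bnd_simp// => fi'.
rewrite Rintegral_setU//; first by rewrite addrC addKr.
apply/disj_setPS => x [] /=; rewrite !in_itv/= => /andP[_ xs] /andP[sx _].
by move: sx; rewrite ltNge xs.
Qed.

Lemma integral_from0_le0 (f : R -> R) (t : R) : t <= 0 -> integral_from0 f t = 0.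
Proof.
by move=> t0; rewrite /integral_from0 set_itv_ge ?Rintegral_set0// bnd_simp -leNgt.
Qed.

Lemma integral_from0_max (f : R -> R) (t : R) :
  integral_from0 f t = integral_from0 f (Num.max 0 t).
Proof. by rewrite /Num.max; case: ltP => // t0; rewrite !integral_from0_le0. Qed.

Lemma integral_from0_dist (f : R -> R) (s t : R) :
  cmu.-integrable setT (EFin \o f) -> 0 <= s <= t ->
  `|integral_from0 f t - integral_from0 f s| <= \int[cmu]_(x in `]s, t]) `|f x|.
Proof.
move=> fi st; rewrite integral_from0B//; apply: le_normr_Rintegral => //.
exact: integrableS fi.
Qed.

(** Absolute continuity of the integral provides [d]; replacing both times by their maximum with 0
    reduces to nonnegative ones. *)
Lemma continuous_integral_from0 (f : R -> R) : cmu.-integrable setT (EFin \o f) ->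
  continuous (integral_from0 f).
Proof.
move=> fi s; apply/cvgrPdist_lt => e e0.
have [d [d0 dP]] := integral_normr_continuous fi e0.
have dist a b : 0 <= a <= b -> b - a < d ->
    `|integral_from0 f b - integral_from0 f a| < e.
  move=> /andP[a0 ab] bad; apply: le_lt_trans (integral_from0_dist fi _) _.
    by rewrite a0 ab.
  apply: dP => //; rewrite [X in (X < _)%E](lebesgue_measure_itv `]a, b])/= lte_fin.
  by case: ifPn => // _; rewrite ?lte_fin// -EFinD lte_fin.
near=> t.
have td : `|s - t| < d by near: t; exact: cvgr_dist_lt.
rewrite [integral_from0 f s]integral_from0_max.
rewrite [integral_from0 f t]integral_from0_max.
have H a b : 0 <= Num.max 0 a <= Num.max 0 b -> a <= b -> `|a - b| < d ->
   Num.max 0 b - Num.max 0 a < d.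
  move=> ab ab' abd; apply: le_lt_trans abd.
  rewrite distrC ger0_norm ?subr_ge0//.
  rewrite /Num.max; case: ltP => b0; case: ltP => a0; lra.
have [st|ts] := leP s t.
- have st0 : 0 <= Num.max 0 s <= Num.max 0 t.
    by apply/andP; split; [rewrite le_max lexx|exact: le_max2].
  by rewrite distrC; apply: dist => //; exact: H.
- have st0 : 0 <= Num.max 0 t <= Num.max 0 s.
    apply/andP; split; first by rewrite le_max lexx.
    by apply: le_max2 => //; exact: ltW.
  by apply: dist => //; apply: (H _ _ st0 (ltW ts)); rewrite distrC.
Unshelve. all: by end_near. Qed.

(** Links the closed intervals of [solution] to [integral_from0]: the point 0 is null. *)
Lemma Rintegral_itv_cc_oc (f : R -> R) (t : R) :
  cmu.-integrable `[0, t] (EFin \o f) ->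
  \int[cmu]_(x in `[0, t]) f x = integral_from0 f t.
Proof.
move=> fi; have [t0|t0] := leP 0 t; last first.
  by rewrite integral_from0_le0 ?ltW// set_itv_ge ?Rintegral_set0// bnd_simp -ltNge.
have E : `[0, t]%classic = [set 0] `|` `]0, t]%classic :> set R.
  by rewrite -(set_itv1 0) -itv_bndbnd_setU ?bnd_simp.
move: fi; rewrite E => fi.
have m1 : measurable ([set 0] : set cR) by exact: measurable_completed.
rewrite Rintegral_setU//.
- rewrite /Rintegral null_set_integral ?add0r//.
  + apply: (measurable_funS _ _ (measurable_int _ fi)) => //.
    exact: measurableU.
  + exact: (lebesgue_measure_set1 0).
- by apply/disj_setPS => x [] /= ->; rewrite in_itv/= ltxx.
Qed.

End integral_from0.

(** * Chain rule along absolutely continuous paths *)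

Section gradients.
Context {R : realType}.
Notation cmu := (@completed_lebesgue_measure R).
Notation cR := (caratheodory_type ((wlength (@idfun R))^*)%mu).


Lemma row_cvg (n : nat) (T : Type) (F : set_system T) (FF : Filter F)
    (f : T -> 'rV[R]_n) (l : 'rV[R]_n) :
  (forall i, (f t 0 i) @[t --> F] --> l 0 i) -> f @ F --> l.
Proof.
move=> fl; apply/cvg_ballP => e e0.
have : \forall t \near F, forall i, ball (l 0 i) e (f t 0 i).
  by apply: filter_forall => i; have /cvg_ballP := fl i; exact.
by apply: filterS => t ft; split => // i j; rewrite ord1.
Qed.

Lemma coord_cvg (n : nat) (T : Type) (F : set_system T) (FF : Filter F)
    (f : T -> 'rV[R]_n) (l : 'rV[R]_n) i :
  f @ F --> l -> (f t 0 i) @[t --> F] --> l 0 i.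
Proof. 
move=> fl; apply: (@cvg_comp _ _ _ f (fun v : 'rV[R]_n => v 0 i) F (nbhs l)) => //.
exact: coord_continuous.
 Qed.

Lemma dotE (n : nat) (v w : 'rV[R]_n) : dot v w = \sum_i v 0 i * w 0 i.
Proof. by rewrite /dot mxE; apply: eq_bigr => i _; rewrite mxE. Qed.

Lemma diff_gradient (n : nat) (V : 'rV[R]_n -> R) (x h : 'rV[R]_n) :
  differentiable V x -> 'd V x h = dot (gradient V x) h.
Proof.
move=> dV; rewrite dotE [in LHS](row_sum_delta h) linear_sum.
by apply: eq_bigr => i _; rewrite linearZ/= mxE deriveE// mulrC.
Qed.

Lemma norm_row_le (n : nat) (v : 'rV[R]_n) (c : 'I_n -> R) :
  (forall i, `|v 0 i| <= c i) -> `|v| <= \sum_i c i.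
Proof.
move=> vc; have c0 i : 0 <= c i by exact: le_trans (vc i).
have [->|/mx_norm_neq0] := eqVneq `|v| 0; first exact: sumr_ge0.
move=> [[i j] vE]; rewrite [leLHS]vE /= ord1.
rewrite (le_trans (vc j))// (bigD1 j)//= lerDl.
exact: sumr_ge0.
Qed.

Lemma near_first_order (n : nat) (V : 'rV[R]_n -> R) (x : 'rV[R]_n) (e : R) :
  differentiable V x -> 0 < e ->
  \forall y \near x, `|V y - V x - dot (gradient V x) (y - x)| <= e * `|y - x|.
Proof.
move=> dV e0; have /eqaddoP/(_ _ e0) := diff_locally dV.
rewrite (near_shift 0 x) subr0; apply: filterS => y /=.
by rewrite !fctE/= addrK diff_gradient// opprD addrA.
Qed.

Lemma RintegralN (D : set cR) (f : R -> R) : measurable D ->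
  cmu.-integrable D (EFin \o f) ->
  \int[cmu]_(x in D) (- f x) = - \int[cmu]_(x in D) f x.
Proof.
move=> mD fi; under eq_Rintegral do rewrite -mulN1r.
by rewrite RintegralZl// mulN1r.
Qed.

Lemma Rintegral_sum (D : set cR) (I : finType) (f : I -> R -> R) : measurable D ->
  (forall i, cmu.-integrable D (EFin \o f i)) ->
  \int[cmu]_(x in D) (\sum_i f i x) = \sum_i \int[cmu]_(x in D) f i x.
Proof.
move=> mD fi; rewrite /Rintegral.
under eq_integral do rewrite -sumEFin.
rewrite integral_sum//.
have E i : (\int[cmu]_(x in D) (f i x)%:E = (\int[cmu]_(x in D) f i x)%:E)%E.
  by rewrite /Rintegral fineK//; exact: (integrable_fin_num mD (fi i)).
by under eq_bigr do rewrite E; rewrite sumEFin.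
Qed.

Lemma integrable_Rsum (D : set cR) (I : finType) (f : I -> R -> R) :
  measurable D ->
  (forall i, cmu.-integrable D (EFin \o f i)) ->
  cmu.-integrable D (fun x => (\sum_i f i x)%:E).
Proof.
move=> mD fi; under eq_fun do rewrite -sumEFin.
by apply: integrable_sum => // i _; exact: fi.
Qed.

End gradients.

Section chain_rule_along_paths.
Context {R : realType}.
Notation cmu := (@completed_lebesgue_measure R).
Notation cR := (caratheodory_type ((wlength (@idfun R))^*)%mu).


Lemma continuous_bounded_itv (f : R -> R) (a b : R) :
  {within `[a, b], continuous f} -> [bounded f x | x in `[a, b]].
Proof.
move=> cf.
have /compact_bounded[M [Mr HM]] := continuous_compact cf (@segment_compact R a b).
by exists M; split => // y My x xab; apply: HM => //; exists x.
Qed.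

Lemma integrable_mul_continuous (f w : R -> R) (T : R) :
  (forall t, 0 <= t <= T -> {for t, continuous w}) ->
  cmu.-integrable `[0, T] (EFin \o f) ->
  cmu.-integrable `[0, T] (EFin \o (fun t => w t * f t)).
Proof.
move=> cw fi.
have cwT : {within `[0, T], continuous w}.
  by apply: continuous_in_subspaceT => t; rewrite inE/= in_itv/=; exact: cw.
rewrite (_ : EFin \o _ = (EFin \o w) \* (EFin \o f))%E; last by apply/funext.
apply: integrableMr => //; last exact: continuous_bounded_itv.
apply: measurable_fun_completed; first exact: measurable_itv.
exact: subspace_continuous_measurable_fun.
Qed.

(** Constant for t <= 0, hence continuous on the whole line for integrable [g], whereas a [solution]
    is unconstrained at negative times. *)
Definition path_from (n : nat) (x0 : 'rV[R]_n) (g : R -> 'rV[R]_n) (t : R) :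
    'rV[R]_n :=
  \row_i (x0 0 i + integral_from0 (fun s => g s 0 i) t).

Lemma continuous_path_from (n : nat) (x0 : 'rV[R]_n) (g : R -> 'rV[R]_n) :
  (forall i, cmu.-integrable setT (EFin \o (fun t => g t 0 i))) ->
  continuous (path_from x0 g).
Proof.
move=> gi t; apply: row_cvg => i; rewrite mxE.
under eq_fun do rewrite mxE.
by apply: cvgD; [exact: cvg_cst|exact: continuous_integral_from0].
Qed.

Section chain_rule.
Variables (n : nat) (x0 : 'rV[R]_n) (g : R -> 'rV[R]_n).
Variables (V : 'rV[R]_n -> R) (T : R).
Hypothesis gi : forall i, cmu.-integrable setT (EFin \o (fun t => g t 0 i)).
Hypothesis T0 : 0 <= T.
Let X := path_from x0 g.
Hypothesis dV : forall t, 0 <= t <= T -> differentiable V (X t).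
Hypothesis cV : forall t, 0 <= t <= T -> {for X t, continuous (gradient V)}.
Let k t := dot (gradient V (X t)) (g t).
Let w i t := gradient V (X t) 0 i.

Let cX : continuous X. Proof. exact: continuous_path_from. Qed.

Let cw i t : 0 <= t <= T -> {for t, continuous (w i)}.
Proof.
move=> tT; apply: (@coord_cvg _ _ _ _ _ (gradient V \o X)).
by apply: continuous_comp; [exact: cX|exact: cV].
Qed.

Let giT i (D : set cR) : measurable D ->
  cmu.-integrable D (EFin \o (fun t => g t 0 i)).
Proof. by move=> mD; apply: integrableS (gi i). Qed.

Let wgi i : cmu.-integrable `[0, T] (EFin \o (fun t => w i t * g t 0 i)).
Proof. by apply: integrable_mul_continuous; [exact: cw|exact: giT]. Qed.

Let kE t : k t = \sum_i w i t * g t 0 i. Proof. exact: dotE. Qed.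

Lemma chain_rule_integrable : cmu.-integrable `[0, T] (EFin \o k).
Proof.
rewrite (_ : EFin \o k = fun t => (\sum_i w i t * g t 0 i)%:E); last first.
  by apply/funext => t /=; rewrite kE.
exact: integrable_Rsum.
Qed.

(** The cut-off makes the integrand integrable on the whole line, as continuity of [integral_from0]
    requires. *)
Let k0 := k \_ `[0, T].
Let k0i : cmu.-integrable setT (EFin \o k0).
Proof.
have [] := (integrable_mkcond (D := `[0, T]%classic : set cR) (mu := cmu)
  (EFin \o k)) => // + _.
by move=> /(_ chain_rule_integrable); rewrite restrict_EFin.
Qed.

Let W t := V (X t) - integral_from0 k0 t.
Let G t := \sum_i integral_from0 (fun s => `|g s 0 i|) t.

Let gni i : cmu.-integrable setT (EFin \o (fun s => `|g s 0 i|)).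
Proof. exact: (integrable_norm (gi i)). Qed.

Let GB s t : 0 <= s <= t ->
  G t - G s = \sum_i \int[cmu]_(x in `]s, t]) `|g x 0 i|.
Proof.
by move=> st; rewrite /G -sumrB; apply: eq_bigr => i _; exact: integral_from0B.
Qed.

Let XB s t i : 0 <= s <= t -> (X t - X s) 0 i = \int[cmu]_(x in `]s, t]) g x 0 i.
Proof.
by move=> st; rewrite !mxE opprD addrACA subrr add0r; exact: integral_from0B.
Qed.

Let normXB s t : 0 <= s <= t -> `|X t - X s| <= G t - G s.
Proof.
move=> st; rewrite GB//; apply: norm_row_le => i; rewrite XB//.
by apply: le_normr_Rintegral => //; exact: giT.
Qed.

Let k0B s t : 0 <= s <= t -> t <= T ->
  integral_from0 k0 t - integral_from0 k0 s =
  \sum_i \int[cmu]_(x in `]s, t]) (w i x * g x 0 i).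
Proof.
move=> /andP[s0 st] tT; rewrite integral_from0B ?s0//.
have sub : `]s, t]%classic `<=` (`[0, T]%classic : set R).
  move=> x /=; rewrite !in_itv/= => /andP[sx xt].
  by rewrite (le_trans s0 (ltW sx)) (le_trans xt tT).
transitivity (\int[cmu]_(x in `]s, t]) \sum_i w i x * g x 0 i).
  apply: eq_Rintegral => x /[!inE] xst.
  by rewrite /k0 patchE mem_set ?kE//; exact: sub.
rewrite Rintegral_sum// => i.
by apply: integrableS (wgi i).
Qed.

(* W is the defect of the chain rule and G bounds the variation of the path; since
   V is differentiable at X s and gradient V \o X is continuous at s, the
   increments of W are negligible with respect to those of G. *)
Let local_estimate (e s : R) : 0 < e -> 0 <= s < T ->
  \forall t \near s^'+, `|W t - W s| <= 2 * e * (G t - G s).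
Proof.
move=> e0 /andP[s0 sT].
have sT' : 0 <= s <= T by rewrite s0 ltW.
have : \forall t \near s, forall i, `|w i s - w i t| <= e.
  apply: (@filter_forall R _ (fun i => [set t | `|w i s - w i t| <= e]) (nbhs s)).
  move=> i.
  by have /cvgrPdist_le := @cw i s sT'; exact.
move=> /nbhs_ballP[d /= d0 dP].
have near1 : \forall t \near s,
    `|V (X t) - V (X s) - dot (gradient V (X s)) (X t - X s)| <= e * `|X t - X s|.
  exact: (cX (near_first_order (dV sT') e0)).
near=> t.
have st : s < t by near: t; exact: nbhs_right_gt.
have tT : t <= T by near: t; exact: nbhs_right_le.
have tsd : t < s + d by near: t; apply: nbhs_right_lt; rewrite ltrDl.
have st' : 0 <= s <= t by rewrite s0 ltW.
(* First half of the error: the Taylor remainder of [V] at [X s]. *)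
have H1 : `|V (X t) - V (X s) - dot (gradient V (X s)) (X t - X s)| <=
    e * (G t - G s).
  apply: (@le_trans _ _ (e * `|X t - X s|)); last by rewrite ler_pM2l// normXB.
  by near: t; apply: cvg_within; exact: near1.
have sub : `]s, t]%classic `<=` (`[0, T]%classic : set R).
  move=> x /=; rewrite !in_itv/= => /andP[sx xt].
  by rewrite (le_trans s0 (ltW sx)) (le_trans xt tT).
have wgi' i : cmu.-integrable `]s, t] (EFin \o (fun x => w i x * g x 0 i)).
  by apply: integrableS (wgi i).
(* Second half: freezing the gradient at time [s] under the integral costs at most [e] times the
   variation, coordinate by coordinate. *)
have H2 : `|dot (gradient V (X s)) (X t - X s) -
    (integral_from0 k0 t - integral_from0 k0 s)| <= e * (G t - G s).
  rewrite k0B// dotE GB// mulr_sumr -sumrB (le_trans (ler_norm_sum _ _ _))//.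
  apply: ler_sum => i _; rewrite XB//.
  rewrite -[X in X - _](RintegralZl (w i s) (measurable_itv_completed _)
    (giT i (measurable_itv_completed _))).
  have wsi : cmu.-integrable `]s, t] (EFin \o (fun x => w i s * g x 0 i)).
    by apply: (integrableZl _ (w i s) (giT i _)).
  have wd : cmu.-integrable `]s, t]
      (EFin \o (fun x => w i s * g x 0 i - w i x * g x 0 i)).
    exact: (integrableB (measurable_itv_completed _) wsi (wgi' i)).
  have gni' : cmu.-integrable `]s, t] (EFin \o (fun x => `|g x 0 i|)).
    by apply: integrableS (gni i).
  rewrite -[X in `|X|](RintegralB (measurable_itv_completed _) wsi (wgi' i)).
  rewrite -[leRHS](RintegralZl e (measurable_itv_completed _) gni').
  apply: le_trans (le_normr_Rintegral (measurable_itv_completed _) wd) _.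
  apply: (le_Rintegral (measurable_itv_completed _)).
  - exact: (integrable_norm wd).
  - exact: (integrableZl (measurable_itv_completed _) e gni').
  - move=> x /= xst; rewrite -mulrBl normrM ler_wpM2r//.
    apply: dP; rewrite -ball_normE/=; move: xst; rewrite in_itv/= => /andP[sx xt].
    by rewrite ltr0_norm ?subr_lt0//; lra.
rewrite /W (_ : _ - _ =
  (V (X t) - V (X s) - dot (gradient V (X s)) (X t - X s)) +
  (dot (gradient V (X s)) (X t - X s) -
   (integral_from0 k0 t - integral_from0 k0 s))); last by ring.
apply: le_trans (ler_normD _ _) _; lra.
Unshelve. all: by end_near. Qed.

(** By real induction both [W] and its opposite, minus [2 * e * G], do not increase from 0 to [T].
    Letting [e] tend to 0 gives W(T) = W(0). *)
Lemma chain_rule : V (X T) = V x0 + \int[cmu]_(t in `[0, T]) k t.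
Proof.
have cG : continuous G.
  move=> s; apply: cvg_big => [|i _]; first exact: add_continuous.
  exact: continuous_integral_from0.
have cW s : 0 <= s <= T -> {for s, continuous W}.
  move=> sT; apply: cvgB; last exact: continuous_integral_from0.
  by apply: continuous_comp; [exact: cX|exact/differentiable_continuous/dV].
have G0 : 0 <= G T.
  by apply: sumr_ge0 => i _; apply: Rintegral_ge0.
have G00 : G 0 = 0 by rewrite /G big1// => i _; exact: integral_from0_le0.
have est e : 0 < e -> `|W T - W 0| <= 2 * e * G T.
  move=> e0; rewrite ler_norml.
  have H1 : W T - 2 * e * G T <= W 0 - 2 * e * G 0.
    apply: (@nonincreasing_of_local _ (fun t => W t - 2 * e * G t)) => //.
      by move=> s sT; apply: cvgB; [exact: cW|apply: cvgMr; exact: cG].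
    move=> s sT; apply: filterS (local_estimate e0 sT) => t.
    by rewrite ler_norml => /andP[_]; lra.
  have H2 : - W T - 2 * e * G T <= - W 0 - 2 * e * G 0.
    apply: (@nonincreasing_of_local _ (fun t => - W t - 2 * e * G t)) => //.
      move=> s sT.
      by apply: cvgB; [apply: cvgN; exact: cW|apply: cvgMr; exact: cG].
    move=> s sT; apply: filterS (local_estimate e0 sT) => t.
    by rewrite ler_norml => /andP[+ _]; lra.
  by move: H1 H2; rewrite G00; lra.
have W0T : W T = W 0.
  apply/eqP; rewrite -subr_eq0 -normr_le0; apply/ler_addgt0Pl => e e0.
  rewrite addr0.
  (* [G T] may be 0, hence the [+ 1] in the denominator. *)
  have G1 : 0 < 2 * (G T + 1) by rewrite mulr_gt0// ltr_wpDl.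
  have := est (e / (2 * (G T + 1))) (divr_gt0 e0 G1).
  move/le_trans; apply.
  have -> : 2 * (e / (2 * (G T + 1))) * G T = e * (G T / (G T + 1)).
    by field; lra.
  by rewrite ler_piMr ?(ltW e0)// ler_pdivrMr; lra.
have X0 : X 0 = x0 by apply/rowP => i; rewrite mxE integral_from0_le0// addr0.
have k0T : integral_from0 k0 T = \int[cmu]_(t in `[0, T]) k t.
  rewrite -(@Rintegral_itv_cc_oc _ k0); last exact: integrableS k0i.
  by apply: eq_Rintegral => x xT; rewrite /k0 patchE xT.
by move: W0T; rewrite /W k0T (@integral_from0_le0 _ k0 0)// X0; lra.
Qed.

End chain_rule.
End chain_rule_along_paths.

(** * Lyapunov functions along solutions *)

Section solutions.
Context {R : realType}.
Notation cmu := (@completed_lebesgue_measure R).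
Notation cR := (caratheodory_type ((wlength (@idfun R))^*)%mu).

Section flow.
Variables (n : nat) (D : set 'rV[R]_n) (f : 'rV[R]_n -> 'rV[R]_n).
Variables (x0 : 'rV[R]_n) (x : R -> 'rV[R]_n).
Hypothesis solx : solution D f x0 x.

(* The velocity is cut off after T, so as to be integrable on the whole line. *)
Lemma solution_path (T : R) : 0 <= T -> exists g : R -> 'rV[R]_n,
  [/\ forall i, cmu.-integrable setT (EFin \o (fun t => g t 0 i)),
      forall t, 0 <= t <= T -> g t = f (x t) &
      forall t, 0 <= t <= T -> path_from x0 g t = x t].
Proof.
move=> T0; have [_ solE] := solx.
pose g t := if (0 <= t <= T) then f (x t) else 0.
have gE t : 0 <= t <= T -> g t = f (x t) by rewrite /g => ->.
have gi i : cmu.-integrable setT (EFin \o (fun t => g t 0 i)).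
  have [+ _] := solE T T0 i.
  move/(integrable_mkcond (D := `[0, T]%classic : set cR) (mu := cmu)).
  move=> /(_ (measurable_itv_completed _)).
  apply: eq_integrable => // t _; rewrite /= patchE /g mem_setE/= in_itv/=.
  by case: ifP => //; rewrite mxE.
exists g; split => // t /[dup] tT /andP[t0 tT'].
apply/rowP => i; rewrite mxE; have [fi ->] := solE t t0 i; congr (_ + _).
have gfi : {in (`[0, t]%classic : set R),
    (fun s => g s 0 i) =1 (fun s => f (x s) 0 i)}.
  move=> s; rewrite inE/= in_itv/= => /andP[s0 st].
  by rewrite gE// s0 (le_trans st).
rewrite -Rintegral_itv_cc_oc; last exact: integrableS (gi i).
exact: eq_Rintegral.
Qed.

Variable V : 'rV[R]_n -> R.

Lemma solution_chain_rule (T : R) : 0 <= T ->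
  (forall t, 0 <= t <= T -> differentiable V (x t)) ->
  (forall t, 0 <= t <= T -> {for x t, continuous (gradient V)}) ->
  cmu.-integrable `[0, T] (EFin \o (fun t => dot (gradient V (x t)) (f (x t)))) /\
  V (x T) = V x0 + \int[cmu]_(t in `[0, T]) dot (gradient V (x t)) (f (x t)).
Proof.
move=> T0 dV cV; have [g [gi gE XE]] := solution_path T0.
have dV' t : 0 <= t <= T -> differentiable V (path_from x0 g t).
  by move=> tT; rewrite XE//; exact: dV.
have cV' t : 0 <= t <= T -> {for path_from x0 g t, continuous (gradient V)}.
  by move=> tT; rewrite XE//; exact: cV.
have kE : {in (`[0, T]%classic : set R),
    (fun t => dot (gradient V (path_from x0 g t)) (g t)) =1
    (fun t => dot (gradient V (x t)) (f (x t)))}.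
  by move=> t; rewrite inE/= in_itv/= => tT; rewrite XE// gE.
split.
  have := chain_rule_integrable gi cV'; apply: eq_integrable => // t tT /=.
  by congr (_%:E); exact: kE.
have := chain_rule gi T0 dV' cV'; rewrite XE ?T0 ?lexx// => ->.
by congr (_ + _); exact: eq_Rintegral.
Qed.

End flow.

(* A point y of S on the boundary would belong to every neighborhood of itself
   within S, so that V y > V y. *)
Lemma unbounded_at_boundary_open (n : nat) (S : set 'rV[R]_n)
    (V : 'rV[R]_n -> R) :
  (forall y, boundary S y -> V x @[x --> within S (nbhs y)] --> +oo) -> open S.
Proof.
move=> Vb; rewrite openE => y Sy; apply: contrapT => nSy.
have /Vb/cvgryPgt/(_ (V y)) : boundary S y by split => //; exact: subset_closure.
by rewrite /= near_withinE => /nbhs_singleton/(_ Sy); rewrite ltxx.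
Qed.

Lemma Rintegral_le0 (A : set cR) (h : R -> R) : measurable A ->
  cmu.-integrable A (EFin \o h) -> (forall t, A t -> h t <= 0) ->
  \int[cmu]_(t in A) h t <= 0.
Proof.
move=> mA hi h0; rewrite -oppr_ge0 -(RintegralN mA hi).
by apply: Rintegral_ge0 => t At; rewrite oppr_ge0 h0.
Qed.

Lemma C1_gradient_continuous (n : nat) (S : set 'rV[R]_n) (V : 'rV[R]_n -> R)
    (y : 'rV[R]_n) : continuously_differentiable_on S V -> open S -> S y ->
  {for y, continuous (gradient V)}.
Proof.
move=> [_ + openS Sy]; rewrite continuous_open_subspace// => /(_ y).
by apply; rewrite inE.
Qed.

Section lyapunov.
Variables (n : nat) (D S : set 'rV[R]_n) (f : 'rV[R]_n -> 'rV[R]_n).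
Variables (V : 'rV[R]_n -> R).
Hypothesis V_C1 : continuously_differentiable_on S V.
Hypothesis openS : open S.
Hypothesis V_le0 : forall y, S y -> dot (gradient V y) (f y) <= 0.

Let dV y : S y -> differentiable V y.
Proof. by case: V_C1 => + _; exact. Qed.

Let cV y : S y -> {for y, continuous (gradient V)}.
Proof. exact: C1_gradient_continuous. Qed.

Variables (x0 : 'rV[R]_n) (x : R -> 'rV[R]_n).
Hypothesis solx : solution D f x0 x.
Hypothesis Sx0 : S x0.

Let x_0 : x 0 = x0.
Proof.
have [g [_ _ XE]] := solution_path solx (lexx 0).
rewrite -XE ?lexx//; apply/rowP => i; rewrite mxE integral_from0_le0 ?lexx//.
by rewrite addr0.
Qed.

(** Consider the first exit time [s]. Before it [V] stays below [V x0]; at [s] the path is on the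
    boundary, where [V] blows up along points of [S]. *)
Lemma lyapunov_stays :
  (forall y, boundary S y -> V z @[z --> within S (nbhs y)] --> +oo) ->
  forall t, 0 <= t -> S (x t).
Proof.
move=> Vb T T0; apply: contrapT => nSxT.
have [g [gi _ XE]] := solution_path solx T0.
set X := path_from x0 g in XE.
have cX : continuous X by exact: continuous_path_from.
pose E := [set t | 0 <= t <= T /\ ~ S (X t)].
have ET : E T by split; rewrite ?T0 ?lexx// XE ?T0 ?lexx.
have infE : has_inf E by split; [exists T|exists 0 => t [/andP[]]].
set s := inf E.
have s0 : 0 <= s by apply: lb_le_inf; [exists T|move=> t [/andP[]]].
have sT : s <= T by apply: ge_inf; [case: infE|].
have before t : 0 <= t < s -> S (X t).
  move=> /andP[t0 ts]; apply: contrapT => nSXt.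
  have : s <= t.
    by apply: ge_inf; [case: infE|split; rewrite ?t0//= (le_trans (ltW ts))].
  by rewrite leNgt ts.
(* The infimum is attained: if [X s] were in the open set [S], no exit could occur shortly after
   [s]. *)
have nSXs : ~ S (X s).
  move=> SXs; have : \forall t \near s, S (X t).
    by apply: cX; exact: (open_nbhs_nbhs (conj openS SXs)).
  move=> /nbhs_ballP[e /= e0 eP].
  have [t Et ts] := inf_adherent e0 infE.
  have st : s <= t by apply: ge_inf => //; case: infE.
  by case: Et => _; apply; apply: eP; rewrite -ball_normE/= ltr_distlC; lra.
have XV t : 0 <= t < s -> V (X t) <= V x0.
  move=> /andP[t0 ts].
  have Sx u : 0 <= u <= t -> S (x u).
    move=> /andP[u0 ut]; rewrite -XE ?u0 ?(le_trans ut) ?(le_trans (ltW ts))//.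
    by apply: before; rewrite u0 (le_lt_trans ut).
  rewrite XE ?t0 ?(le_trans (ltW ts))//.
  have [||ki ->] := @solution_chain_rule _ _ _ _ _ solx V t t0.
  - by move=> u /Sx; exact: dV.
  - by move=> u /Sx; exact: cV.
  rewrite gerDl; apply: Rintegral_le0 => // u; rewrite /= in_itv/= => /Sx.
  exact: V_le0.
have s_gt0 : 0 < s.
  rewrite lt_neqAle s0 andbT; apply/eqP => s00; apply: nSXs.
  by rewrite -s00 XE ?lexx// x_0.
have near_lt : \forall t \near s^'-, 0 <= t < s.
  near=> t; apply/andP; split; near: t; first exact: nbhs_left_ge.
  exact: nbhs_left_lt.
have bX : boundary S (X s).
  split; last by move=> /interior_subset.
  apply: (@closed_cvg _ _ s^'- _ X (closure S) (@closed_closure _ S)).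
    by apply: filterS near_lt => t /before; exact: subset_closure.
  by apply: cvg_at_left_filter; exact: cX.
have := Vb _ bX; move/cvgryPgt/(_ (V x0)); rewrite near_withinE => Vgt.
have : \forall t \near s^'-, S (X t) -> V x0 < V (X t).
  have cXl : X t @[t --> s^'-] --> X s by apply: cvg_at_left_filter; exact: cX.
  exact: (cXl _ Vgt).
move=> H; have [t [t0s Vt]] : exists t, 0 <= t < s /\ (S (X t) -> V x0 < V (X t)).
  by near s^'- => t; exists t; split; near: t.
by have := Vt (before _ t0s); rewrite ltNge XV.
Unshelve. all: by end_near. Qed.

Hypothesis Sx : forall t, 0 <= t -> S (x t).

Lemma lyapunov_chain_rule (T : R) : 0 <= T ->
  cmu.-integrable `[0, T] (EFin \o (fun t => dot (gradient V (x t)) (f (x t)))) /\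
  V (x T) = V x0 + \int[cmu]_(t in `[0, T]) dot (gradient V (x t)) (f (x t)).
Proof.
move=> T0; apply: (solution_chain_rule solx) => // t /andP[t0 _].
- exact/dV/Sx.
- exact/cV/Sx.
Qed.

Lemma lyapunov_nonincreasing (s t : R) : 0 <= s <= t -> V (x t) <= V (x s).
Proof.
move=> /andP[s0 st]; have t0 := le_trans s0 st.
have [ki ->] := lyapunov_chain_rule t0; have [_ ->] := lyapunov_chain_rule s0.
have tU : `[0, t]%classic = `[0, s]%classic `|` `]s, t]%classic :> set R.
  by rewrite -itv_bndbnd_setU ?bnd_simp.
rewrite lerD2l tU Rintegral_setU//.
- rewrite gerDl; apply: Rintegral_le0 => //.
    by apply: integrableS ki => //; rewrite tU.
  move=> u; rewrite /= in_itv/= => /andP[/ltW su _].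
  exact/V_le0/Sx/(le_trans s0).
- by rewrite -tU.
- apply/disj_setPS => u [] /=; rewrite !in_itv/= => /andP[_ us] /andP[su _].
  by move: su; rewrite ltNge us.
Qed.

End lyapunov.
End solutions.

(** * Settling time by separation of variables *)

Section settling.
Context {R : realType}.
Notation cmu := (@completed_lebesgue_measure R).
Notation mu := (@lebesgue_measure R).

Lemma gradient_comp (n : nat) (V : 'rV[R]_n -> R) (Phi : R -> R) (y : 'rV[R]_n) :
  differentiable V y -> derivable Phi (V y) 1 ->
  gradient (Phi \o V) y = Phi^`()%classic (V y) *: gradient V y.
Proof.
move=> dV /derivable1_diffP dPhi; apply/rowP => i; rewrite !mxE.
rewrite deriveE; last exact: differentiable_comp.
by rewrite diff_comp//= diff1E// deriveE// [LHS]mulrC.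
Qed.

Section primitive.
Variables (rho : R -> R) (a gamma : R).
Hypothesis rho_gt0 : forall y : R, 0 < y -> 0 < rho y.
Hypothesis rho_cont : forall y : R, 0 < y -> {for y, continuous rho}.
Hypothesis rho_int : (\int[mu]_(y in `]0%R, +oo[) (rho y)%:E = gamma%:E)%E.
Hypothesis a_gt0 : 0 < a.

(** Starting at [a > 0] avoids the possible singularity of [rho] at 0 and keeps [gamma] as an upper
    bound. *)
Let Phi (y : R) := \int[mu]_(t in `[a, y]) rho t.

Lemma integrable_pos_itv (y : R) : mu.-integrable `[a, y] (EFin \o rho).
Proof.
apply: continuous_compact_integrable; first exact: segment_compact.
apply: continuous_in_subspaceT => t; rewrite inE/= in_itv/= => /andP[at_ _].
by apply: rho_cont; exact: lt_le_trans at_.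
Qed.

Lemma primitive_derive (y : R) : a < y ->
  derivable Phi y 1 /\ Phi^`()%classic y = rho y.
Proof.
move=> ay; have yy1 : y < y + 1 by rewrite ltrDl.
apply: (continuous_FTC1_closed yy1 (integrable_pos_itv _) ay).
by apply: rho_cont; exact: lt_trans ay.
Qed.

Let PhiE (y : R) : (\int[mu]_(t in `[a, y]) (rho t)%:E = (Phi y)%:E)%E.
Proof.
rewrite /Phi /Rintegral fineK//.
by apply: integrable_fin_num => //; exact: integrable_pos_itv.
Qed.

Lemma primitive_le (y : R) : Phi y <= gamma.
Proof.
rewrite -lee_fin -PhiE -rho_int; apply: ge0_subset_integral => //.
- by apply/measurable_EFinP; exact: continuous_pos_measurable_fun.
- by move=> t; rewrite /= in_itv/= andbT => t0; rewrite lee_fin ltW ?rho_gt0.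
- by move=> t; rewrite /= !in_itv/= andbT => /andP[at_ _]; exact: lt_le_trans at_.
Qed.

Lemma primitive_gt0 (y : R) : a < y -> 0 < Phi y.
Proof.
move=> ay.
have [|c] := @EVT_min R rho a y (ltW ay).
  apply: continuous_in_subspaceT => t; rewrite inE/= in_itv/= => /andP[at_ _].
  by apply: rho_cont; exact: lt_le_trans at_.
rewrite in_itv/= => /andP[ac _] cmin.
have rc : 0 < rho c by apply: rho_gt0; exact: lt_le_trans ac.
apply: (@lt_le_trans _ _ (\int[mu]_(t in `[a, y]) rho c)).
  rewrite Rintegral_cst//= lebesgue_measure_itv/= lte_fin ay -EFinB/=.
  by rewrite mulr_gt0// subr_gt0.
apply: le_Rintegral => //.
- apply: continuous_compact_integrable; first exact: segment_compact.
  by apply: continuous_subspaceT => t; exact: cvg_cst.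
- exact: integrable_pos_itv.
Qed.

End primitive.

(* If V were still positive at time T, the primitive Phi of rho would satisfy
   Phi (V (x T)) <= Phi (V x0) - gamma by the chain rule for Phi \o V, whereas the
   total mass of rho is only gamma. *)
Lemma lyapunov_settling (n : nat) (D S : set 'rV[R]_n) (f : 'rV[R]_n -> 'rV[R]_n)
    (V : 'rV[R]_n -> R) (x0 : 'rV[R]_n) (x : R -> 'rV[R]_n) (rho : R -> R)
    (gamma Tp T : R) :
  continuously_differentiable_on S V -> open S ->
  (forall y, S y -> dot (gradient V y) (f y) <= 0) ->
  solution D f x0 x -> S x0 -> (forall t, 0 <= t -> S (x t)) ->
  (forall y : R, 0 < y -> 0 < rho y) ->
  (forall y : R, 0 < y -> {for y, continuous rho}) ->
  (\int[mu]_(y in `]0%R, +oo[) (rho y)%:E = gamma%:E)%E ->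
  (forall y, S y -> 0 < V y ->
     dot (gradient V y) (f y) <= - (gamma / Tp / rho (V y))) ->
  0 < Tp <= T -> V (x T) <= 0.
Proof.
move=> V_C1 openS V_le0 solx Sx0 Sx rho_gt0 rho_cont rho_int decay /andP[Tp0 TpT].
have T0 : 0 <= T by rewrite ltW// (lt_le_trans Tp0).
have [dV' _] := V_C1.
have cV y : S y -> {for y, continuous (gradient V)}.
  exact: C1_gradient_continuous.
rewrite leNgt; apply/negP => VT.
(* Strictly below [v], so that [Phi v] is positive and [Phi] is differentiable at all values of [V]
   met on [0, T], which are at least [v]. *)
set v := V (x T) in VT; pose a := v / 2.
have a0 : 0 < a by rewrite divr_gt0.
have av : a < v by rewrite /a; lra.
pose Phi (y : R) := \int[mu]_(t in `[a, y]) rho t.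
have dPhi (y : R) : a < y -> derivable Phi y 1 /\ Phi^`()%classic y = rho y.
  exact: primitive_derive.
have vle t : 0 <= t <= T -> v <= V (x t).
  by move=> tT; apply: (lyapunov_nonincreasing V_C1 openS V_le0 solx Sx).
have Vcont y : S y -> {for y, continuous V}.
  by move=> /dV'/differentiable_continuous.
have gradE y : S y -> a < V y ->
    gradient (Phi \o V) y = rho (V y) *: gradient V y.
  move=> Sy aVy; have [dP <-] := dPhi _ aVy.
  by apply: gradient_comp => //; exact: dV'.
have PdV t : 0 <= t <= T -> differentiable (Phi \o V) (x t).
  move=> tT; apply: differentiable_comp; first by apply/dV'/Sx; case/andP: tT.
  by apply/derivable1_diffP; apply: (dPhi _ _).1; apply: lt_le_trans (vle _ tT).
have PcV t : 0 <= t <= T -> {for x t, continuous (gradient (Phi \o V))}.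
  move=> tT; have Sxt : S (x t) by apply: Sx; case/andP: tT.
  have aVx : a < V (x t) by apply: lt_le_trans (vle _ tT).
  rewrite /prop_for /continuous_at gradE//.
  (* [gradE] holds only in [S] where [V] exceeds [a]; both conditions persist near [x t], so
     continuity transfers from the explicit formula. *)
  have : rho (V y) *: gradient V y @[y --> x t] -->
      rho (V (x t)) *: gradient V (x t).
    apply: cvgZ; last exact: cV.
      exact: (@nbhs_filter _ (x t)).
    exact: (continuous_comp (Vcont _ Sxt) (rho_cont _ (lt_trans a0 aVx))).
  apply: cvg_trans; apply: (@near_eq_cvg _ _ (nbhs (x t)) (nbhs_filter (x t))).
  near=> y; rewrite gradE//; near: y.
  - exact: (open_nbhs_nbhs (conj openS Sxt)).
  - exact: (cvgr_gt (V (x t)) (Vcont _ Sxt) _ aVx).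
have [ki] := solution_chain_rule solx T0 PdV PcV.
have Phi0 : Phi (V x0) <= gamma by exact: primitive_le.
have Phiv : 0 < Phi v by exact: primitive_gt0.
have gamma0 : 0 < gamma by apply: lt_le_trans Phiv _; exact: primitive_le.
have cT : completed_lebesgue_measure `[0, T] = T%:E.
  rewrite [LHS](lebesgue_measure_itv `[0, T])/= lte_fin (lt_le_trans Tp0)//.
  by rewrite oppr0 adde0.
have ci : cmu.-integrable `[0, T] (EFin \o (fun=> - (gamma / Tp))).
  apply/integrableP; split; first exact: measurable_cst.
  by rewrite /= integral_cst// [X in (_ * X)%E]cT -EFinM ltry.
(* The factor [rho (V (x t))] cancels the decay rate, leaving at most - gamma / Tp, integrated over
   a length of at least [Tp]. *)
have : \int[cmu]_(t in `[0, T]) dot (gradient (Phi \o V) (x t)) (f (x t)) <= - gamma.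
  apply: (@le_trans _ _ (\int[cmu]_(t in `[0, T]) - (gamma / Tp))).
    apply: (le_Rintegral (measurable_itv_completed _) ki ci) => t.
    rewrite /= in_itv/= => tT.
    have Sxt : S (x t) by apply: Sx; case/andP: tT.
    have aVx : a < V (x t) by apply: lt_le_trans (vle _ tT).
    have V0 := lt_trans a0 aVx.
    rewrite gradE// dotE; under eq_bigr do rewrite mxE -mulrA.
    rewrite -mulr_sumr -dotE mulrC -ler_pdivlMr ?rho_gt0// mulNr.
    exact: decay.
  rewrite Rintegral_cst//= [X in fine X]cT/= mulNr lerN2.
  by rewrite -mulrA ler_peMr ?(ltW gamma0)// mulrC ler_pdivlMr// mul1r.
rewrite /= -/v => I_le VE; rewrite VE in Phiv.
by have := lt_le_trans Phiv (lerD Phi0 I_le); rewrite subrr ltxx.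
Unshelve. all: by end_near. Qed.
End settling.

(** * The game *)

(* Being a supremum over simple functions, the integral is monotone even on
   functions that are not measurable. *)
Lemma ge0_le_integral_pointwise d (T : measurableType d) (R : realType)
    (mu : {measure set T -> \bar R}) (D : set T) (f g : T -> \bar R) :
  (forall x, D x -> (0 <= f x)%E) -> (forall x, D x -> (f x <= g x)%E) ->
  (\int[mu]_(x in D) f x <= \int[mu]_(x in D) g x)%E.
Proof.
move=> f0 fg; have g0 x : D x -> (0 <= g x)%E.
  by move=> Dx; exact: le_trans (f0 _ Dx) (fg _ Dx).
rewrite !ge0_integralE//; apply: le_ereal_sup => _ [h /= hf <-].
exists h => //= x; apply: le_trans (hf x) _; rewrite !patchE.
by case: ifPn => //; rewrite inE; exact: fg.
Qed.

(** Positive parts grow and negative parts shrink. This compares costs of deviations whose running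
    cost may not be integrable. *)
Lemma le_integral_pointwise d (T : measurableType d) (R : realType)
    (mu : {measure set T -> \bar R}) (D : set T) (f g : T -> \bar R) :
  (forall x, D x -> (f x <= g x)%E) ->
  (\int[mu]_(x in D) f x <= \int[mu]_(x in D) g x)%E.
Proof.
move=> fg; rewrite integralE [leRHS]integralE; apply: leeB.
- apply: ge0_le_integral_pointwise => // x Dx.
  by rewrite !funeposE; apply: le_max2 => //; exact: fg.
- apply: ge0_le_integral_pointwise => // x Dx.
  by rewrite !funenegE; apply: le_max2 => //; rewrite leeN2; exact: fg.
Qed.

Lemma saddle_nash_equilibrium (R : realType) (P Q : Type) (X : set P) (Y : set Q)
    (J : P -> Q -> \bar R) (u : P) (a : Q) : X u -> Y a ->
  (forall a', Y a' -> (J u a' <= J u a)%E) ->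
  (forall u', X u' -> (J u a <= J u' a)%E) ->
  nash_equilibrium X Y J u a.
Proof.
move=> Xu Ya Ja Ju; split => //.
- apply/eqP; rewrite eq_le; apply/andP; split.
    apply: le_ereal_inf_tmp => _ [u' Xu' <-].
    by apply: le_trans (Ju _ Xu') _; apply: ereal_sup_ubound; exists a.
  apply: (@le_trans _ _ (ereal_sup [set J u a' | a' in Y])).
    by apply: ereal_inf_lbound; exists u.
  by apply: ge_ereal_sup => _ [a' Ya' <-]; exact: Ja.
- apply/eqP; rewrite eq_le; apply/andP; split.
    apply: (@le_trans _ _ (ereal_inf [set J u' a | u' in X])).
      by apply: le_ereal_inf_tmp => _ [u' Xu' <-]; exact: Ju.
    by apply: ereal_sup_ubound; exists a.
  apply: ge_ereal_sup => _ [a' Ya' <-].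
  by apply: le_trans (Ja _ Ya'); apply: ereal_inf_lbound; exists u.
Qed.

Lemma dist_eq0 (R : realType) (n : nat) (C : set 'rV[R]_n) (y : 'rV[R]_n) :
  C y -> dist y C = 0.
Proof.
move=> Cy; have B : lbound [set `|y - x| | x in C] 0 by move=> _ [x _ <-].
apply/eqP; rewrite eq_le; apply/andP; split; last first.
  by apply: lb_le_inf => //; exists `|y - y|, y.
by apply: ge_inf; [exists 0|exists y => //; rewrite subrr normr0].
Qed.

(** [get] chooses some solution; the uniqueness contained in [the_solution] identifies it at
    nonnegative times. *)
Lemma trajectoryE (R : realType) (n : nat) (D : set 'rV[R]_n)
    (g : 'rV[R]_n -> 'rV[R]_n) (x0 : 'rV[R]_n) (x : R -> 'rV[R]_n) :
  the_solution D g x0 x -> forall t, 0 <= t -> trajectory D g x0 t = x t.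
Proof.
move=> xsol; case: (xsol) => _; apply.
have : [set x | the_solution D g x0 x] (trajectory D g x0).
  by apply: getPex; exists x.
by case.
Qed.

Section decrease.
Context {R : realType}.
Notation cmu := (@completed_lebesgue_measure R).

(** The chain rule up to [T], where [V] vanishes. The field [f] is arbitrary, so deviating pairs are
    covered too. *)
Lemma integral_gradient_decrease (n : nat) (D S : set 'rV[R]_n)
    (f : 'rV[R]_n -> 'rV[R]_n) (V : 'rV[R]_n -> R) (x0 : 'rV[R]_n)
    (x : R -> 'rV[R]_n) (T : R) :
  continuously_differentiable_on S V -> open S -> solution D f x0 x ->
  (forall t, 0 <= t -> S (x t)) -> 0 <= T -> V (x T) = 0 ->
  (\int[cmu]_(t in `[0%R, T]) (- dot (gradient V (x t)) (f (x t)))%:E =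
   (V x0)%:E)%E.
Proof.
move=> V_C1 openS solx Sx T0 VT; have [dV _] := V_C1.
have [||ki VE] := @solution_chain_rule _ _ _ _ _ _ solx V T T0.
- by move=> t /andP[t0 _]; exact/dV/Sx.
- by move=> t /andP[t0 _]; exact: C1_gradient_continuous V_C1 openS (Sx _ t0).
have Vx0 : V x0 = \int[cmu]_(t in `[0, T]) - dot (gradient V (x t)) (f (x t)).
  rewrite (RintegralN (measurable_itv_completed _) ki).
  by move/eqP: VE; rewrite VT eq_sym addr_eq0 => /eqP.
rewrite Vx0 /Rintegral fineK//.
apply: integrable_fin_num => //.
have := integrableN ki.
by apply: eq_integrable => // t _; rewrite /= EFinN.
Qed.

End decrease.

Theorem theorem3p2 (R : realType) (n Ns Nc Na m_u m_a : nat)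
  (D S : set 'rV[R]_n) (U : set 'rV[R]_m_u) (A : set 'rV[R]_m_a)
  (F : 'rV[R]_n -> 'rV[R]_Ns -> 'rV[R]_m_u -> 'rV[R]_m_a -> 'rV[R]_n)
  (rcost : 'rV[R]_n -> 'rV[R]_m_u -> 'rV[R]_m_a -> R)
  (Tp : R) (thetas : 'rV[R]_Ns) (thetac : 'rV[R]_Nc) (thetaa : 'rV[R]_Na)
  (Fu : 'rV[R]_n -> set ('rV[R]_n -> 'rV[R]_m_u))
  (Fa : 'rV[R]_n -> set ('rV[R]_n -> 'rV[R]_m_a))
  (V : 'rV[R]_n -> R) (alpha beta p q r : R)
  (ustar : 'rV[R]_n -> 'rV[R]_Nc -> 'rV[R]_m_u)
  (astar : 'rV[R]_n -> 'rV[R]_Na -> 'rV[R]_m_a)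
  (openD : open D) (D0 : D 0) (SD : S `<=` D) (S0 : S 0) (U0 : U 0) (A0 : A 0)
  (Tp_gt0 : 0 < Tp)
  (Fcont : forall theta, {within D `*` U `*` A,
     continuous (fun z : 'rV[R]_n * 'rV[R]_m_u * 'rV[R]_m_a =>
       F z.1.1 theta z.1.2 z.2)})
  (Fzero : forall theta, F 0 theta 0 0 = 0)
  (rcont : {within S `*` U `*` A,
     continuous (fun z : 'rV[R]_n * 'rV[R]_m_u * 'rV[R]_m_a =>
       rcost z.1.1 z.1.2 z.2)})
  (pairs_nonempty : forall x0, S x0 ->
     stabilizing_pairs D S U A Tp F thetas x0 !=set0)
  (pairs_product : forall x0, S x0 ->
     Fu x0 `*` Fa x0 = stabilizing_pairs D S U A Tp F thetas x0)
  (ustar_strategy : strategy S U ustar) (astar_strategy : strategy S A astar)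
  (well_posed : forall x0, S x0 -> exists x,
     feedback_solution D U A F thetas (ustar^~ thetac) (astar^~ thetaa) x0 x)
  (V_C1 : continuously_differentiable_on S V)
  (alpha_gt0 : 0 < alpha) (beta_gt0 : 0 < beta)
  (p_gt0 : 0 < p) (q_gt0 : 0 < q) (r_gt0 : 0 < r)
  (pr_lt1 : p * r < 1) (qr_gt1 : 1 < q * r)
  (H_eq0 : forall x, S x ->
     hamiltonian F rcost x thetas (ustar x thetac) (astar x thetaa)
       (gradient V x) = 0)
  (H_le0 : forall x a, S x -> A a ->
     hamiltonian F rcost x thetas (ustar x thetac) a (gradient V x) <= 0)
  (H_ge0 : forall x u, S x -> U u ->
     0 <= hamiltonian F rcost x thetas u (astar x thetaa) (gradient V x))
  (ustar0 : ustar 0 thetac = 0) (astar0 : astar 0 thetaa = 0)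
  (V0 : V 0 = 0) (V_gt0 : forall x, S x -> x != 0 -> 0 < V x)
  (V_boundary : forall y, boundary S y -> V x @[x --> within S (nbhs y)] --> +oo)
  (V_decay : forall x, S x ->
     dot (gradient V x) (F x thetas (ustar x thetac) (astar x thetaa)) <=
       - (settling_gain alpha beta p q r / Tp *
          (alpha * V x `^ p + beta * V x `^ q) `^ r))
  (S_bounded_or_V_coercive :
     bounded_set S \/ (~ bounded_set S /\ coercive S V)) :
  [/\ safely_predefined_time_stable D S Tp (closed_loop F ustar astar),
      safely_predefined_time_stable_with D S Tp (closed_loop F ustar astar)
        (row_mx (row_mx thetas thetac) thetaa) &
      forall x0, S x0 ->
        nash_equilibrium (Fu x0) (Fa x0) (cost D Tp F rcost thetas x0)
          (ustar^~ thetac) (astar^~ thetaa) /\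
        cost D Tp F rcost thetas x0 (ustar^~ thetac) (astar^~ thetaa)
          = (V x0)%:E].
Proof.
pose phi := ustar^~ thetac; pose psi := astar^~ thetaa.
pose f := feedback_field F thetas phi psi.
pose rho y : R := ((alpha * y `^ p + beta * y `^ q) `^ r)^-1.
pose gamma := settling_gain alpha beta p q r.
have openS : open S by exact: unbounded_at_boundary_open V_boundary.
have rho_int := integral_inv_rate alpha_gt0 beta_gt0 p_gt0 q_gt0 r_gt0
  pr_lt1 qr_gt1.
have rate_gt0 (y : R) : 0 < y -> 0 < alpha * y `^ p + beta * y `^ q.
  by move=> y0; rewrite addr_gt0// mulr_gt0// powR_gt0.
have rho_gt0 (y : R) : 0 < y -> 0 < rho y.
  by move=> y0; rewrite invr_gt0 powR_gt0// rate_gt0.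
have rho_cont (y : R) : 0 < y -> {for y, continuous rho}.
  move=> y0; apply: cvgV; first by rewrite gt_eqF// powR_gt0// rate_gt0.
  apply: (@continuous_comp _ _ _ (fun y : R => alpha * y `^ p + beta * y `^ q)
    (fun z : R => z `^ r)); last exact/continuous_powR_gt0/rate_gt0.
  by apply: cvgD; apply: cvgMr; exact: continuous_powR_gt0.
(* The sign is read off the integral representation of the gain. *)
have gamma_ge0 : 0 <= gamma.
  rewrite -lee_fin -rho_int; apply: integral_ge0 => y.
  by rewrite lee_fin invr_ge0 powR_ge0.
have V_le0 y : S y -> dot (gradient V y) (f y) <= 0.
  move=> Sy; apply: le_trans (V_decay _ Sy) _; rewrite oppr_le0.
  by rewrite mulr_ge0 ?powR_ge0// divr_ge0// ltW.
have decay y : S y -> 0 < V y ->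
    dot (gradient V y) (f y) <= - (gamma / Tp / rho (V y)).
  by move=> Sy _; rewrite /rho invrK; exact: V_decay.
have fb_phi : feedback_law S U phi by exact: ustar_strategy.
have fb_psi : feedback_law S A psi by exact: astar_strategy.
have stab x0 : S x0 -> exists x, [/\ feedback_solution D U A F thetas phi psi x0 x,
    remains_in S x & forall t, Tp <= t -> x t = 0].
  move=> Sx0; have [x xfb] := well_posed _ Sx0; exists x.
  have [[xsol _] _ _] := xfb.
  have Sx : forall t, 0 <= t -> S (x t).
    exact: (lyapunov_stays V_C1 openS V_le0 xsol Sx0 V_boundary).
  split => //; first by move=> t t0; split; [exact/dist_eq0/Sx|exact: Sx].
  move=> t Tpt; have t0 : 0 <= t by rewrite (le_trans (ltW Tp_gt0)).
  apply/eqP; apply: contraT => xt0.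
  have := @lyapunov_settling _ _ _ _ _ _ _ _ _ _ _ t V_C1 openS V_le0 xsol Sx0 Sx
    rho_gt0 rho_cont rho_int decay.
  by rewrite Tp_gt0 Tpt => /(_ isT); rewrite leNgt V_gt0//; exact: Sx.
have pair x0 : S x0 -> (Fu x0 `*` Fa x0) (phi, psi).
  by move=> Sx0; rewrite pairs_product//; split => //; exact: stab.
have cl : (closed_loop F ustar astar)^~ (row_mx (row_mx thetas thetac) thetaa) = f.
  by apply/funext => x; rewrite /closed_loop !(row_mxKl, row_mxKr).
have stable : safely_predefined_time_stable_with D S Tp (closed_loop F ustar astar)
    (row_mx (row_mx thetas thetac) thetaa).
  split.
    have -> : closed_loop F ustar astar 0
        (row_mx (row_mx thetas thetac) thetaa) = f 0 by rewrite -cl.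
    by rewrite /f /feedback_field /phi /psi ustar0 astar0 Fzero.
  move=> x0 /stab[x [[xsol _ _] Sx xT]]; exists x; split => //.
  by rewrite cl.
split; [by exists (row_mx (row_mx thetas thetac) thetaa)|exact: stable|].
move=> x0 Sx0; have [Fu0 Fa0] := pair _ Sx0.
(* Membership in the product yields a stabilizing pair, so every such trajectory dissipates exactly
   [V x0] by time [Tp]. *)
have along phi' psi' : Fu x0 phi' -> Fa x0 psi' -> exists x,
  [/\ the_solution D (feedback_field F thetas phi' psi') x0 x,
      forall t, 0 <= t -> [/\ S (x t), U (phi' (x t)) & A (psi' (x t))] &
      (\int[@completed_lebesgue_measure R]_(t in `[0%R, Tp])
        (- dot (gradient V (x t)) (feedback_field F thetas phi' psi' (x t)))%:E =
       (V x0)%:E)%E].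
  move=> uF aF; have : (Fu x0 `*` Fa x0) (phi', psi') by [].
  rewrite pairs_product// => -[[/= uU _ _ _] [/= aA _ _ _] [x [[xsol _ _] Sx xT]]].
  have Sx' t : 0 <= t -> S (x t) by move=> /Sx[].
  exists x; split => //.
    by move=> t /Sx' Sxt; split => //; [exact: uU|exact: aA].
  have [xs _] := xsol.
  by rewrite (integral_gradient_decrease V_C1 openS xs Sx' (ltW Tp_gt0))// xT.
have costE phi' psi' x :
    the_solution D (feedback_field F thetas phi' psi') x0 x ->
    cost D Tp F rcost thetas x0 phi' psi' =
    (\int[@completed_lebesgue_measure R]_(t in `[0%R, Tp])
      (rcost (x t) (phi' (x t)) (psi' (x t)))%:E)%E.
  move=> xsol; rewrite /cost; apply: eq_integral => t.
  by rewrite inE/= in_itv/= => /andP[t0 _]; rewrite (trajectoryE xsol).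
(* A vanishing Hamiltonian equates the running cost with the dissipation - V'(x) F. *)
have cost_eq : cost D Tp F rcost thetas x0 phi psi = (V x0)%:E.
  have [x [xsol Sx <-]] := along _ _ Fu0 Fa0; rewrite (costE _ _ _ xsol).
  apply: eq_integral => t; rewrite inE/= in_itv/= => /andP[t0 _].
  have [Sxt _ _] := Sx _ t0; congr (_%:E); apply/eqP.
  by rewrite -addr_eq0; apply/eqP; exact: H_eq0.
split; last exact: cost_eq.
apply: saddle_nash_equilibrium; [exact: Fu0|exact: Fa0| |].
- move=> psi' aF; rewrite -/phi -/psi cost_eq.
  have [x [xsol Sx <-]] := along _ _ Fu0 aF; rewrite (costE _ _ _ xsol).
  apply: le_integral_pointwise => t; rewrite /= in_itv/= => /andP[t0 _].
  (* The running cost minus the dissipation is the Hamiltonian, here nonpositive as only the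
     adversary deviates. *)
  have [Sxt _ At] := Sx _ t0; rewrite lee_fin -subr_le0 opprK.
  exact: H_le0.
- move=> phi' uF; rewrite -/phi -/psi cost_eq.
  have [x [xsol Sx <-]] := along _ _ uF Fa0; rewrite (costE _ _ _ xsol).
  apply: le_integral_pointwise => t; rewrite /= in_itv/= => /andP[t0 _].
  have [Sxt Ut _] := Sx _ t0; rewrite lee_fin -subr_ge0 opprK.
  exact: H_ge0.
Qed.
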